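(* Let $N\ge1$ be an integer and $-1<\gamma<1$. Let $f(\cdot;\alpha)$, $\alpha>0$, be the profiles and let $0<\alpha_0<\alpha_1<\alpha_2<\dots$ be the sequence of similarity exponents defined in the context. For each similarity exponent $\alpha_k$ ($k\ge 0$) and each $\alpha$ such that $\alpha_k<\alpha\le\alpha_{k+1}$, the profile $f(\cdot;\alpha)$ has exactly $k$ zeros in $[0,\infty)$. If $0<\alpha\le\alpha_0$, then $f(\eta;\alpha)>0$ for all $\eta\ge0$.
   Context: Let $\sigma:\mathbb{R}\to\mathbb{R}$ be given by $\sigma(z)=-\frac{1-\gamma}{2}$ if $z>0$ and $\sigma(z)=-\frac{1+\gamma}{2}$ if $z\le 0$. For $\alpha>0$, the profile $f=f(\cdot;\alpha):[0,\infty)\to\mathbb{R}$ is the unique solution of the nonlinear Cauchy problem $$f''+\frac{N-1}{\eta}f'=\sigma(\alpha f+\eta f')\,(\alpha f+\eta f')\quad(\eta>0),\qquad f(0)=1,\quad f'(0)=0 .$$ Equivalently, $u_\alpha(x,t)=t^{-\alpha/2}f(\|x\|/\sqrt t;\alpha)$ is a similarity solution of $u_t+\gamma|u_t|=\Delta u$ in $\mathbb{R}^N\times(0,\infty)$, with the normalization $f(0)=1$. The sequence $(\alpha_k)_{k\ge0}$ of similarity exponents is the increasing, unbounded sequence of positive numbers such that, for every $k\ge 0$, $f(\eta;\alpha_k)\sim \eta^{\alpha_k-N}e^{-\frac{1+(-1)^k\gamma}{4}\eta^2}$ for $\eta$ large, while for every $\alpha>0$ not in the sequence, $f(\eta;\alpha)\sim\eta^{-\alpha}$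 for $\eta$ large. Here $g\sim h$ means that $g(\eta)/h(\eta)$ converges to a nonzero real constant as $\eta\to\infty$. (The existence of such a sequence is a separate result and may be assumed here.)
   Formalization: For α_k<α≤α_{k+1} the profile is proved to have exactly k+1 zeros, not k: with γ=0, N=1, α_0=1, α_1=3, the profile f(η;3)=(1-η²/2)e^{-η²/4} has one zero, so the count k fails for k=0. *)

(* Defs.v *)
From Stdlib Require Import Reals Lra List.
From Coquelicot Require Import Coquelicot.
Open Scope R_scope.

Definition sigma (gamma z : R) : R :=
  if Rlt_dec 0 z then - ((1 - gamma) / 2) else - ((1 + gamma) / 2).

Definition is_right_derive (f : R -> R) (x l : R) : Prop :=
  filterlim (fun y => (f y - f x) / (y - x)) (at_right x) (locally l).

(* Classical solutions on [0, +oo), i.e. C^1 up to eta = 0, with f'(0) a right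
   derivative.  The values of f on the negative half-line play no role. *)
Definition is_profile (N : nat) (gamma alpha : R) (f : R -> R) : Prop :=
  f 0 = 1 /\
  is_right_derive f 0 0 /\
  filterlim (Derive f) (at_right 0) (locally 0) /\
  (forall eta : R, 0 < eta ->
     ex_derive f eta /\
     ex_derive (Derive f) eta /\
     Derive (Derive f) eta + (INR N - 1) / eta * Derive f eta =
       sigma gamma (alpha * f eta + eta * Derive f eta) *
         (alpha * f eta + eta * Derive f eta)).

(* The ratio tends to a nonzero constant, not necessarily 1. *)
Definition asymp (g h : R -> R) : Prop :=
  exists l : R, l <> 0 /\ is_lim (fun eta => g eta / h eta) p_infty l.

Definition is_similarity_exponents (N : nat) (gamma : R)
    (f : R -> R -> R) (a : nat -> R) : Prop :=
  (forall k : nat, 0 < a k) /\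
  (forall k : nat, a k < a (S k)) /\
  is_lim_seq a p_infty /\
  (forall k : nat,
     asymp (f (a k))
       (fun eta => Rpower eta (a k - INR N) *
          exp (- ((1 + (-1) ^ k * gamma) / 4 * eta ^ 2)))) /\
  (forall alpha : R, 0 < alpha -> (forall k : nat, alpha <> a k) ->
     asymp (f alpha) (fun eta => Rpower eta (- alpha))).

Definition has_exactly_zeros (n : nat) (f : R -> R) : Prop :=
  exists l : list R,
    NoDup l /\ length l = n /\
    forall eta : R, In eta l <-> 0 <= eta /\ f eta = 0.

(* Main.v *)
Require Import Defs.
From Stdlib Require Import Reals Lra Lia ZArith List ClassicalEpsilon.
From Coquelicot Require Import Coquelicot.
Open Scope R_scope.

(** The term [- sigma z * z] equals [phi gamma z = z / 2 - gamma / 2 * |z|], an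
    increasing, 1-Lipschitz function that is positively homogeneous of degree one.
    Because of the homogeneity, in polar coordinates [f = r cos theta],
    [f' = - r sin theta] the radius drops out and the angle solves a scalar
    first-order equation [theta' = slope eta theta].  The slope is [1] wherever
    [cos theta = 0], so the zeros of f are the successive upward crossings of the
    nodes [n PI + PI / 2], each crossed once ([angle_upcrossing]).  Having at most n
    zeros therefore means that theta stays below node n ([stays_below]), and the
    theorem says which exponents have this property.

    Dependence on alpha.  The slope is nondecreasing in alpha, and theta behaves like
    [eta * phi alpha / N] at the origin, so theta increases strictly with alpha
    ([angle_increasing_in_alpha]), and it is locally Lipschitz in alpha
    ([angle_lipschitz_in_alpha]).  Hence the exponents for which theta stays below
    node n form an interval that is closed on the right, and zeros can only appear
    from infinity as alpha grows.

    Behaviour at infinity.  Let [c = (1 + (-1)^n gamma) / 2] be the slope of phi that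
    acts when f has the sign [(-1)^n] and decays, and let [0 < delta < c].  For large
    eta the curve [n PI + atan (delta eta)], that is [f' / f = - delta eta], cannot be
    crossed upwards, uniformly for bounded alpha ([barrier_at_infinity]).  Below this
    curve f is at least of the order of [exp (- delta eta^2 / 2)]; above it, at most
    of that order.  This gives three facts.
    - A slowly decaying profile goes below the curve, where it is trapped, and so do
      the profiles of slightly larger exponents: no zero appears just above alpha
      ([stays_below_right_of_slow]).
    - Just above any alpha, at most one zero appears, because the angle is trapped
      under the curve of index n + 1 as long as it is below node n at a large eta
      ([stays_below_S_right]).
    - A fast decaying profile stays above the curve for [delta = 3 c / 4].  If a larger
      exponent had no further zero, the difference D of the tangents of the two
      angles would satisfy [D' >= D^2] for all large eta, and D would blow up
      ([not_stays_below_of_fast]).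

    By induction on k, theta stays below node k exactly for the exponents up to [a k]
    ([critical_angles]).  For k = 0 one starts from a small exponent, for which
    [atan (delta eta)] is a barrier on the whole half-line ([stays_below_small]);
    afterwards one starts just above [a k].  Between two consecutive [a k] the decay
    is slow, so the property persists up to the next one.  The induction also yields
    the sign of [f (a k)] at infinity, which is what makes the assumed Gaussian rate
    the right one. *)

(** * Calculus on an interval *)

Lemma nondecreasing_of_derive (g dg : R -> R) (a b : R) :
  a <= b ->
  (forall t, a <= t <= b -> is_derive g t (dg t)) ->
  (forall t, a <= t <= b -> 0 <= dg t) ->
  g a <= g b.
Proof.
  intros ab Hd Hpos.
  destruct (MVT_gen g a b dg) as [c [Hc E]].
  - intros x Hx; rewrite Rmin_left, Rmax_right in Hx by lra; apply Hd; lra.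
  - intros x Hx; rewrite Rmin_left, Rmax_right in Hx by lra.
    apply derivable_continuous_pt; exists (dg x); apply is_derive_Reals, Hd; lra.
  - rewrite Rmin_left, Rmax_right in Hc by lra.
    assert (0 <= dg c * (b - a)) by (apply Rmult_le_pos; [apply Hpos; lra | lra]).
    lra.
Qed.

Lemma increasing_of_derive (g dg : R -> R) (a b : R) :
  a < b ->
  (forall t, a <= t <= b -> is_derive g t (dg t)) ->
  (forall t, a <= t <= b -> 0 < dg t) ->
  g a < g b.
Proof.
  intros ab Hd Hpos.
  destruct (MVT_gen g a b dg) as [c [Hc E]].
  - intros x Hx; rewrite Rmin_left, Rmax_right in Hx by lra; apply Hd; lra.
  - intros x Hx; rewrite Rmin_left, Rmax_right in Hx by lra.
    apply derivable_continuous_pt; exists (dg x); apply is_derive_Reals, Hd; lra.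
  - rewrite Rmin_left, Rmax_right in Hc by lra.
    assert (0 < dg c * (b - a)) by (apply Rmult_lt_0_compat; [apply Hpos; lra | lra]).
    lra.
Qed.

Lemma constant_of_derive_zero (g : R -> R) (a b : R) :
  a <= b -> (forall t, a <= t <= b -> is_derive g t 0) -> g a = g b.
Proof.
  intros ab Hd. apply Rle_antisym.
  - apply (nondecreasing_of_derive g (fun _ => 0)); auto; intros; lra.
  - apply Ropp_le_cancel.
    apply (nondecreasing_of_derive (fun t => - g t) (fun _ => 0)); auto; [|intros; lra].
    intros t Ht. replace 0 with (opp 0) by (unfold opp; simpl; lra).
    apply @is_derive_opp, Hd, Ht.
Qed.

(** The zero is the supremum of the points up to which g stays positive. *)
Lemma first_zero (g : R -> R) (a b : R) :
  a <= b ->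
  (forall t, a <= t <= b -> continuity_pt g t) ->
  0 < g a -> g b <= 0 ->
  exists t, a < t <= b /\ g t = 0 /\ (forall s, a <= s < t -> 0 < g s).
Proof.
  intros ab Hc ga gb.
  set (E := fun x => a <= x <= b /\ forall s, a <= s <= x -> 0 < g s).
  destruct (completeness E) as [t [Hub Hlub]].
  - exists b; intros x [Hx _]; lra.
  - exists a; split; [lra|]. intros s Hs; replace s with a by lra; exact ga.
  - assert (Hat : a <= t).
    { apply Hub; split; [lra|]. intros s Hs; replace s with a by lra; exact ga. }
    assert (Htb : t <= b) by (apply Hlub; intros x [Hx _]; lra).
    assert (Hbelow : forall s, a <= s < t -> 0 < g s).
    { intros s Hs. destruct (Rlt_dec 0 (g s)) as [p|np]; [exact p|exfalso].
      assert (t <= s); [|lra].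
      apply Hlub; intros x [Hx Hpos].
      destruct (Rle_dec x s); [lra|exfalso; apply np, Hpos; lra]. }
    assert (Hgt : g t = 0).
    { destruct (Rtotal_order (g t) 0) as [neg|[z|pos]]; [exfalso|exact z|exfalso].
      - destruct (Hc t (conj Hat Htb) (- g t)) as [d [Hd Hcd]]; [lra|].
        destruct (Req_dec t a) as [->|nta]; [lra|].
        set (s := Rmax a (t - d / 2)).
        assert (a <= s < t) by (unfold s, Rmax; destruct (Rle_dec a (t - d/2)); lra).
        assert (t - d / 2 <= s) by apply Rmax_r.
        assert (Hs := Hbelow s H).
        assert (Hn : Rabs (g s - g t) < - g t).
        { apply (Hcd s); split; [split; [exact I|lra]|].
          simpl; unfold Rdist; apply Rabs_def1; lra. }
        apply Rabs_def2 in Hn; lra.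
      - destruct (Hc t (conj Hat Htb) (g t)) as [d [Hd Hcd]]; [lra|].
        assert (Hnear : forall s, Rabs (s - t) < d -> 0 < g s).
        { intros s Hs. destruct (Req_dec s t) as [->|nst]; [exact pos|].
          assert (Hn : Rabs (g s - g t) < g t).
          { apply (Hcd s); split; [split; [exact I|lra]|exact Hs]. }
          apply Rabs_def2 in Hn; lra. }
        destruct (Rlt_dec t b) as [tb|ntb].
        + set (s := Rmin b (t + d / 2)).
          assert (Hs : t < s <= b /\ s <= t + d / 2)
            by (unfold s, Rmin; destruct (Rle_dec b (t + d/2)); lra).
          assert (s <= t); [|lra].
          apply Hub; split; [lra|]. intros u Hu.
          destruct (Rlt_dec u t); [apply Hbelow; lra|].
          apply Hnear, Rabs_def1; lra.
        + replace b with t in gb by lra; lra. }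
    exists t; split; [|split; [exact Hgt|exact Hbelow]].
    split; [|exact Htb].
    destruct (Req_dec a t) as [<-|]; lra.
Qed.

Lemma is_derive_continuity_pt (g : R -> R) (t l : R) :
  is_derive g t l -> continuity_pt g t.
Proof.
  intros H; apply derivable_continuous_pt; exists l; apply is_derive_Reals, H.
Qed.

Lemma is_derive_lt_near (g : R -> R) (t l : R) :
  is_derive g t l -> 0 < l ->
  exists d, 0 < d /\
    (forall s, t - d < s < t -> g s < g t) /\ (forall s, t < s < t + d -> g t < g s).
Proof.
  intros H Hl. apply is_derive_Reals in H.
  destruct (H l Hl) as [d Hd].
  assert (Hq : forall h, h <> 0 -> Rabs h < d -> 0 < (g (t + h) - g t) / h).
  { intros h h0 hd. specialize (Hd h h0 hd). apply Rabs_def2 in Hd; lra. }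
  exists d; split; [apply cond_pos|split].
  - intros s Hs.
    assert (P := Hq (s - t) ltac:(lra) ltac:(apply Rabs_def1; lra)).
    replace (t + (s - t)) with s in P by ring.
    assert (E : g s - g t = (g s - g t) / (s - t) * (s - t)) by (field; lra).
    nra.
  - intros s Hs.
    assert (P := Hq (s - t) ltac:(lra) ltac:(apply Rabs_def1; lra)).
    replace (t + (s - t)) with s in P by ring.
    assert (E : g s - g t = (g s - g t) / (s - t) * (s - t)) by (field; lra).
    nra.
Qed.

(** At its first zero g would come from positive values, which a positive derivative
    forbids. *)
Lemma positive_of_barrier (g dg : R -> R) (a b : R) :
  a <= b ->
  (forall t, a <= t <= b -> is_derive g t (dg t)) ->
  (forall t, a <= t <= b -> g t = 0 -> 0 < dg t) ->
  0 < g a -> 0 < g b.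
Proof.
  intros ab Hd Hz ga.
  destruct (Rlt_dec 0 (g b)) as [p|np]; [exact p|exfalso].
  destruct (first_zero g a b ab) as [t [Ht [gt Hb]]]; [|exact ga|lra|].
  { intros t Ht; eapply is_derive_continuity_pt, Hd, Ht. }
  destruct (is_derive_lt_near g t (dg t)) as [d [dp [Hl _]]].
  { apply Hd; lra. }
  { apply Hz; [lra|exact gt]. }
  set (s := Rmax a (t - d / 2)).
  assert (Hs : a <= s < t /\ t - d / 2 <= s)
    by (unfold s, Rmax; destruct (Rle_dec a (t - d/2)); lra).
  specialize (Hl s ltac:(lra)). specialize (Hb s ltac:(lra)). lra.
Qed.

Lemma positive_of_barrier_at_zero (g dg : R -> R) (a b : R) :
  a < b ->
  (forall t, a <= t <= b -> is_derive g t (dg t)) ->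
  (forall t, a <= t <= b -> g t = 0 -> 0 < dg t) ->
  0 <= g a -> 0 < g b.
Proof.
  intros ab Hd Hz [ga|ga].
  { apply (positive_of_barrier g dg a b); auto; lra. }
  destruct (is_derive_lt_near g a (dg a)) as [d [dp [_ Hr]]].
  { apply Hd; lra. }
  { apply Hz; [lra|auto]. }
  set (s := Rmin b (a + d / 2)).
  assert (Hs : a < s <= b /\ s <= a + d / 2)
    by (unfold s, Rmin; destruct (Rle_dec b (a + d/2)); lra).
  apply (positive_of_barrier g dg s b); try lra.
  - intros t Ht; apply Hd; lra.
  - intros t Ht; apply Hz; lra.
  - specialize (Hr s ltac:(lra)); lra.
Qed.

(** Up to the first zero of g, [g t * exp (L * t)] is nondecreasing, hence bounded
    below by a positive constant. *)
Lemma positive_of_gronwall (g dg : R -> R) (L a b : R) :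
  a <= b ->
  (forall t, a <= t <= b -> is_derive g t (dg t)) ->
  (forall t, a <= t <= b -> 0 <= g t -> - L * g t <= dg t) ->
  0 < g a -> 0 < g b.
Proof.
  intros ab Hd Hz ga.
  destruct (Rlt_dec 0 (g b)) as [p|np]; [exact p|exfalso].
  destruct (first_zero g a b ab) as [t [Ht [gt Hb]]]; [|exact ga|lra|].
  { intros t Ht; eapply is_derive_continuity_pt, Hd, Ht. }
  assert (M : g a * exp (L * a) <= g t * exp (L * t)).
  { apply (nondecreasing_of_derive (fun s => g s * exp (L * s))
             (fun s => (dg s + L * g s) * exp (L * s))); [lra| |].
    - intros s Hs.
      assert (Hds : is_derive g s (dg s)) by (apply Hd; lra).
      auto_derive; [exists (dg s); exact Hds|].
      replace (Derive (fun x => g x) s) with (dg s) by (symmetry; exact (is_derive_unique _ _ _ Hds)).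
      ring.
    - intros s Hs. apply Rmult_le_pos; [|left; apply exp_pos].
      assert (0 <= g s).
      { destruct (Req_dec s t) as [->|]; [lra|left; apply Hb; lra]. }
      specialize (Hz s ltac:(lra) H); lra. }
  rewrite gt in M. assert (0 < exp (L * a)) by apply exp_pos. nra.
Qed.

(** A substitute for the value at 0: only the limit of G at the right of 0 is used, since
    profiles are controlled on the open half-line only. *)
Lemma positive_of_increasing_from_zero (G dG : R -> R) (e : R) :
  (forall t, 0 < t < e -> is_derive G t (dG t)) ->
  (forall t, 0 < t < e -> 0 < dG t) ->
  (forall eps, 0 < eps -> exists d, 0 < d /\ forall s, 0 < s < d -> Rabs (G s) < eps) ->
  forall t, 0 < t < e -> 0 < G t.
Proof.
  intros Hd Hp H0 t Ht.
  assert (Hhalf : G (t / 2) < G t).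
  { apply (increasing_of_derive G dG); [lra| |]; intros s Hs; [apply Hd|apply Hp]; lra. }
  destruct (Rle_dec 0 (G (t / 2))) as [|n]; [lra|exfalso].
  destruct (H0 (- G (t / 2))) as [d [dp Hdd]]; [lra|].
  set (s := Rmin (t / 2) (d / 2)).
  assert (Hs : 0 < s <= t / 2 /\ s < d)
    by (unfold s, Rmin; destruct (Rle_dec (t / 2) (d/2)); lra).
  assert (G s <= G (t / 2)).
  { apply (nondecreasing_of_derive G dG); [lra| |]; intros u Hu;
      [apply Hd|left; apply Hp]; lra. }
  specialize (Hdd s ltac:(lra)). apply Rabs_def2 in Hdd. lra.
Qed.

(** Since [D' >= D^2], the function [- 1 / D - t] is nondecreasing, which would make
    [- 1 / D] positive at a finite time. *)
Lemma no_global_riccati (D dD : R -> R) R0 :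
  (forall t, R0 <= t -> is_derive D t (dD t)) ->
  (forall t, R0 <= t -> 0 < D t) ->
  (forall t, R0 <= t -> D t ^ 2 <= dD t) -> False.
Proof.
  intros Hd Hp Hq.
  assert (D0 := Hp R0 ltac:(lra)).
  assert (I0 : 0 < / D R0) by (apply Rinv_0_lt_compat, D0).
  (* An upper bound of the blow-up time is R0 + 1 / D R0. *)
  set (t := R0 + / D R0 + 1).
  assert (M : - / D R0 - R0 <= - / D t - t).
  { apply (nondecreasing_of_derive (fun u => - / D u - u) (fun u => dD u / D u ^ 2 - 1));
      [unfold t; lra| |].
    - intros u Hu. assert (Du := Hp u ltac:(lra)). assert (E := Hd u ltac:(lra)).
      auto_derive; [repeat split; [eexists; exact E|lra]|].
      change (Derive (fun x => D x) u) with (Derive D u).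
      rewrite (is_derive_unique D u _ E). field. lra.
    - intros u Hu. assert (Du := Hp u ltac:(lra)). specialize (Hq u ltac:(lra)).
      assert (P : 0 < D u ^ 2) by (apply pow_lt, Du).
      replace (dD u / D u ^ 2 - 1) with ((dD u - D u ^ 2) / D u ^ 2) by (field; lra).
      apply Rdiv_le_0_compat; lra. }
  assert (Dt : 0 < / D t) by (apply Rinv_0_lt_compat, Hp; unfold t; lra).
  unfold t in M at 2. lra.
Qed.

Lemma at_right_0_eps (g : R -> R) (l : R) :
  filterlim g (at_right 0) (locally l) ->
  forall eps, 0 < eps -> exists d, 0 < d /\ forall t, 0 < t < d -> Rabs (g t - l) < eps.
Proof.
  intros H eps He.
  destruct (proj1 (filterlim_locally g l) H (mkposreal eps He)) as [d Hd].
  exists d; split; [apply cond_pos|]. intros t Ht.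
  apply (Hd t); [|lra].
  change (Rabs (t - 0) < d). apply Rabs_def1; lra.
Qed.

(** * Elementary functions and the nodes *)

Lemma INR_ge1 N : (1 <= N)%nat -> 1 <= INR N.
Proof. intros H. change 1 with (INR 1). now apply le_INR. Qed.

Lemma cos_atan_pos z : 0 < cos (atan z).
Proof. assert (B := atan_bound z). apply cos_gt_0; lra. Qed.

Lemma sin_atan_cos z : sin (atan z) = z * cos (atan z).
Proof.
  assert (P := cos_atan_pos z).
  rewrite <- (tan_atan z) at 2. unfold tan. field. lra.
Qed.

Lemma cos_atan_sqr z : cos (atan z) ^ 2 * (1 + z ^ 2) = 1.
Proof.
  assert (T := sin2_cos2 (atan z)). unfold Rsqr in T. rewrite sin_atan_cos in T.
  transitivity (z * cos (atan z) * (z * cos (atan z)) + cos (atan z) * cos (atan z));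
    [ring|exact T].
Qed.

Lemma atan_le z : 0 <= z -> atan z <= z.
Proof.
  intros Hz.
  enough (0 - atan 0 <= z - atan z) by (rewrite atan_0 in *; lra).
  apply (nondecreasing_of_derive (fun u => u - atan u) (fun u => u ^ 2 / (1 + u ^ 2)));
    [exact Hz| |]; intros u _; assert (Q := pow2_ge_0 u).
  - auto_derive; [exact I|]. field. lra.
  - apply Rdiv_le_0_compat; lra.
Qed.

Lemma atan_le_reg x y : atan x <= atan y -> x <= y.
Proof.
  intros H. apply Rnot_lt_le. intros L. apply atan_increasing in L. lra.
Qed.

Lemma sin_lipschitz x y : Rabs (sin y - sin x) <= Rabs (y - x).
Proof.
  destruct (MVT_gen sin x y cos) as [c [_ E]].
  - intros t _. apply is_derive_Reals, derivable_pt_lim_sin.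
  - intros t _. apply continuity_sin.
  - rewrite E, Rabs_mult. assert (B := COS_bound c).
    assert (Rabs (cos c) <= 1) by (apply Rabs_le; lra).
    assert (P := Rabs_pos (y - x)). nra.
Qed.

Lemma cos_lipschitz x y : Rabs (cos y - cos x) <= Rabs (y - x).
Proof.
  rewrite !cos_sin. eapply Rle_trans; [apply sin_lipschitz|].
  right. f_equal. ring.
Qed.

Lemma cos_add_nPI n x : cos (INR n * PI + x) = (-1) ^ n * cos x.
Proof.
  induction n as [|n IH].
  - simpl. rewrite Rmult_0_l, Rplus_0_l. ring.
  - rewrite S_INR. replace ((INR n + 1) * PI + x) with (INR n * PI + x + PI) by ring.
    rewrite neg_cos, IH. simpl. ring.
Qed.

Lemma sin_add_nPI n x : sin (INR n * PI + x) = (-1) ^ n * sin x.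
Proof.
  induction n as [|n IH].
  - simpl. rewrite Rmult_0_l, Rplus_0_l. ring.
  - rewrite S_INR. replace ((INR n + 1) * PI + x) with (INR n * PI + x + PI) by ring.
    rewrite neg_sin, IH. simpl. ring.
Qed.

Lemma ln_le_id t : 0 < t -> ln t <= t.
Proof.
  intros Ht. assert (E := exp_ineq1_le (ln t)). rewrite exp_ln in E by exact Ht. lra.
Qed.

Lemma exp_le x y : x <= y -> exp x <= exp y.
Proof. intros [H| ->]; [left; now apply exp_increasing|right; reflexivity]. Qed.

Lemma exp_sqr x : exp x ^ 2 = exp (2 * x).
Proof. replace (2 * x) with (x + x) by ring. rewrite exp_plus. ring. Qed.

Lemma exp_quadratic_unbounded e q K M :
  0 < e -> exists t, M < t /\ K < exp (e * t ^ 2 - q * t).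
Proof.
  intros He.
  set (X := (Rabs q + 1 + Rabs K) / e).
  assert (q0 := Rabs_pos q). assert (K0 := Rabs_pos K). assert (M0 := Rabs_pos M).
  assert (HX : 0 < X) by (apply Rdiv_lt_0_compat; lra).
  assert (EX : e * X = Rabs q + 1 + Rabs K) by (unfold X; field; lra).
  exists (1 + Rabs M + X).
  assert (Mm := Rle_abs M). assert (Km := Rle_abs K). assert (qm := Rle_abs q).
  split; [lra|]. set (t := 1 + Rabs M + X).
  assert (1 <= t /\ X <= t) by (unfold t; lra).
  assert (B : 1 + Rabs K <= e * t ^ 2 - q * t).
  { assert (e * X <= e * t) by (apply Rmult_le_compat_l; lra). nra. }
  assert (E := exp_ineq1_le (e * t ^ 2 - q * t)). lra.
Qed.

(** The angles at which the cosine vanishes; node n is the angle of the zero of rank n,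
    counted from 0. *)
Definition node (n : nat) : R := INR n * PI + PI / 2.

Lemma cos_node n : cos (node n) = 0.
Proof. unfold node. rewrite cos_add_nPI, cos_PI2. ring. Qed.

Lemma node_S n : node (S n) = node n + PI.
Proof. unfold node. rewrite S_INR. ring. Qed.

Lemma node_mono i j : (i <= j)%nat -> node i <= node j.
Proof.
  intros H. unfold node. apply le_INR in H. assert (P := PI_RGT_0). nra.
Qed.

Lemma node_inj i j : node i = node j -> i = j.
Proof.
  intros H. assert (P := PI_RGT_0). unfold node in H.
  apply INR_eq, (Rmult_eq_reg_r PI); lra.
Qed.

Lemma node_of_cos_zero x n :
  0 < x < node n -> cos x = 0 -> exists j, (j < n)%nat /\ x = node j.
Proof.
  intros Hx Hc. destruct (cos_eq_0_0 x Hc) as [k Hk].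
  assert (P := PI_RGT_0). unfold node in Hx.
  assert (K0 : (0 <= k)%Z).
  { assert (-1 < k)%Z; [|lia]. apply lt_IZR. simpl.
    apply (Rmult_lt_reg_r PI); [exact P|]. lra. }
  assert (Kn : (k < Z.of_nat n)%Z).
  { apply lt_IZR. rewrite <- INR_IZR_INZ. apply (Rmult_lt_reg_r PI); [exact P|]. lra. }
  exists (Z.to_nat k). split; [lia|]. unfold node.
  rewrite INR_IZR_INZ, Z2Nat.id by exact K0. exact Hk.
Qed.

Lemma branch_lt_node n z : INR n * PI + atan z < node n.
Proof. unfold node. assert (B := atan_bound z). lra. Qed.

Lemma node_lt_branch n z : node n < INR (S n) * PI + atan z.
Proof. rewrite S_INR. unfold node. assert (B := atan_bound z). lra. Qed.

(** Between two nodes, an angle is determined by the tangent, which is [- f' / f] for the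
    angle of a profile. *)
Lemma branch_of_tan n x :
  node n - PI < x < node n -> x = INR n * PI + atan (tan (x - INR n * PI)).
Proof. unfold node. intros H. rewrite atan_tan by lra. ring. Qed.

(** * The nonlinearity *)

Definition phi (gamma z : R) : R := z / 2 - gamma / 2 * Rabs z.

Lemma sigma_phi gamma z : Defs.sigma gamma z * z = - phi gamma z.
Proof.
  unfold Defs.sigma, phi. destruct (Rlt_dec 0 z).
  - rewrite Rabs_pos_eq by lra; field.
  - rewrite Rabs_left1 by lra; field.
Qed.

Lemma phi_pos gamma z : 0 <= z -> phi gamma z = (1 - gamma) / 2 * z.
Proof. intros; unfold phi; rewrite Rabs_pos_eq by lra; field. Qed.

Lemma phi_neg gamma z : z <= 0 -> phi gamma z = (1 + gamma) / 2 * z.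
Proof. intros; unfold phi; rewrite Rabs_left1 by lra; field. Qed.

Lemma phi_scale gamma r z : 0 <= r -> phi gamma (r * z) = r * phi gamma z.
Proof. intros; unfold phi; rewrite Rabs_mult, (Rabs_pos_eq r) by lra; field. Qed.

Lemma phi_opp gamma z : phi gamma (- z) = - phi (- gamma) z.
Proof. unfold phi; rewrite Rabs_Ropp; field. Qed.

Lemma phi_increments gamma x y :
  -1 < gamma < 1 -> x <= y -> 0 <= phi gamma y - phi gamma x <= y - x.
Proof.
  intros Hg Hxy; unfold phi.
  destruct (Rle_dec 0 x).
  - rewrite !Rabs_pos_eq by lra; nra.
  - destruct (Rle_dec 0 y).
    + rewrite (Rabs_left1 x), (Rabs_pos_eq y) by lra; nra.
    + rewrite !Rabs_left1 by lra; nra.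
Qed.

Lemma phi_lipschitz gamma x y :
  -1 < gamma < 1 -> Rabs (phi gamma y - phi gamma x) <= Rabs (y - x).
Proof.
  intros Hg. destruct (Rle_dec x y) as [H|H].
  - assert (P := phi_increments gamma x y Hg H). rewrite !Rabs_pos_eq; lra.
  - assert (P := phi_increments gamma y x Hg ltac:(lra)).
    rewrite !(Rabs_left1 (_ - _)); lra.
Qed.

Lemma phi_0 gamma : phi gamma 0 = 0.
Proof. unfold phi; rewrite Rabs_R0; field. Qed.

Lemma phi_abs_le gamma z : -1 < gamma < 1 -> Rabs (phi gamma z) <= Rabs z.
Proof.
  intros Hg; assert (H := phi_lipschitz gamma 0 z Hg).
  rewrite phi_0, !Rminus_0_r in H; exact H.
Qed.

Lemma pow_neg1_cases n : (-1) ^ n = 1 \/ (-1) ^ n = -1.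
Proof. induction n as [|n [H|H]]; simpl; [left|right|left]; lra. Qed.

Lemma pow_neg1_mult n gamma : -1 < gamma < 1 -> -1 < (-1) ^ n * gamma < 1.
Proof. intros; destruct (pow_neg1_cases n) as [->| ->]; lra. Qed.

(** Changing the sign of f amounts to changing the sign of gamma: on the branches of
    odd index the equation is the one for [- gamma]. *)
Lemma phi_branch n gamma z :
  (-1) ^ n * phi gamma ((-1) ^ n * z) = phi ((-1) ^ n * gamma) z.
Proof.
  destruct (pow_neg1_cases n) as [->| ->].
  - now rewrite !Rmult_1_l.
  - replace (-1 * z) with (- z) by ring. rewrite phi_opp.
    replace (-1 * gamma) with (- gamma) by ring. ring.
Qed.

Lemma phi_alpha_pos gamma alpha : -1 < gamma < 1 -> 0 < alpha -> 0 < phi gamma alpha <= alpha.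
Proof. intros Hg H. rewrite phi_pos by lra. nra. Qed.

(** * From a profile to its polar angle *)

(** The derivative of the polar angle of [(f, - f')], obtained from the equation of f
    divided by r. *)
Definition slope (N : nat) (gamma alpha eta theta : R) : R :=
  sin theta ^ 2 - (INR N - 1) / eta * (sin theta * cos theta)
  + cos theta * phi gamma (alpha * cos theta - eta * sin theta).

(** The slope is singular at [eta = 0], so the initial condition is expressed by the
    behaviour of theta there: theta is equivalent to [eta * phi alpha / N], given
    here by comparison with the curves [atan (K * eta)], which also serve as
    barriers. *)
Definition is_angle (N : nat) (gamma alpha : R) (f theta : R -> R) : Prop :=
  (forall eta, 0 < eta -> is_derive theta eta (slope N gamma alpha eta (theta eta))) /\
  (forall eta, 0 < eta -> exists r, 0 < r /\
     f eta = r * cos (theta eta) /\ Derive f eta = - (r * sin (theta eta))) /\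
  (forall K, INR N * K < phi gamma alpha -> exists d, 0 < d /\
     forall eta, 0 < eta < d -> atan (K * eta) < theta eta) /\
  (forall K, phi gamma alpha < INR N * K -> exists d, 0 < d /\
     forall eta, 0 < eta < d -> theta eta < atan (K * eta)).

Section Profile.

Context (N : nat) (gamma alpha : R) (f : R -> R).
Hypothesis N_ge1 : (1 <= N)%nat.
Hypothesis gamma_bounds : -1 < gamma < 1.
Hypothesis alpha_pos : 0 < alpha.
Hypothesis profile : is_profile N gamma alpha f.

Definition accel (eta : R) : R :=
  - ((INR N - 1) / eta * Derive f eta) - phi gamma (alpha * f eta + eta * Derive f eta).

Lemma profile_derive eta : 0 < eta -> is_derive f eta (Derive f eta).
Proof. intros H; apply Derive_correct, profile, H. Qed.

Lemma profile_derive2 eta : 0 < eta -> is_derive (Derive f) eta (accel eta).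
Proof.
  intros H. destruct profile as (_ & _ & _ & ode).
  destruct (ode eta H) as (_ & Hd & E). rewrite sigma_phi in E.
  replace (accel eta) with (Derive (Derive f) eta) by (unfold accel; lra).
  apply Derive_correct, Hd.
Qed.

Lemma profile_near_zero eps :
  0 < eps -> exists d, 0 < d /\
    forall t, 0 < t < d -> Rabs (f t - 1) < eps /\ Rabs (Derive f t) < eps.
Proof.
  intros He. destruct profile as (f0 & df0 & ddf0 & _).
  destruct (at_right_0_eps _ _ df0 1 Rlt_0_1) as [d1 [p1 H1]].
  destruct (at_right_0_eps _ _ ddf0 eps He) as [d2 [p2 H2]].
  exists (Rmin eps (Rmin d1 d2)); split.
  { repeat apply Rmin_glb_lt; assumption. }
  intros t Ht.
  assert (t < eps /\ t < d1 /\ t < d2) as (te & t1 & t2).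
  { assert (M1 := Rmin_l eps (Rmin d1 d2)). assert (M2 := Rmin_r eps (Rmin d1 d2)).
    assert (M3 := Rmin_l d1 d2). assert (M4 := Rmin_r d1 d2). lra. }
  split.
  - specialize (H1 t ltac:(lra)). rewrite f0, Rminus_0_r in H1.
    replace (f t - 1) with ((f t - 1) / (t - 0) * t) by (field; lra).
    rewrite Rabs_mult, (Rabs_pos_eq t) by lra.
    assert (P := Rabs_pos ((f t - 1) / (t - 0))). nra.
  - specialize (H2 t ltac:(lra)). now rewrite Rminus_0_r in H2.
Qed.

(** Backward uniqueness: if f and f' vanished at eta, a Gronwall estimate on
    [f^2 + f'^2] from eta back to a small e would make f vanish at e, against
    [f 0 = 1]. *)
Lemma profile_energy_pos eta : 0 < eta -> 0 < f eta ^ 2 + Derive f eta ^ 2.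
Proof.
  intros Heta.
  destruct (Rlt_dec 0 (f eta ^ 2 + Derive f eta ^ 2)) as [p|np]; [exact p|exfalso].
  destruct (profile_near_zero (1 / 2)) as [d [dp Hd]]; [lra|].
  set (e := Rmin (eta / 2) (d / 2)).
  assert (He : 0 < e <= eta / 2 /\ e <= d / 2)
    by (unfold e, Rmin; destruct (Rle_dec (eta / 2) (d / 2)); lra).
  assert (N1 := INR_ge1 N N_ge1).
  (* On [e, eta] the derivative of f^2 + f'^2 is at least - C (f^2 + f'^2). *)
  set (C := 1 + 2 * ((INR N - 1) / e) + alpha + 2 * eta).
  assert (M : (f e ^ 2 + Derive f e ^ 2) * exp (C * e)
              <= (f eta ^ 2 + Derive f eta ^ 2) * exp (C * eta)).
  { apply (nondecreasing_of_derive (fun s => (f s ^ 2 + Derive f s ^ 2) * exp (C * s))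
      (fun s => (2 * f s * Derive f s + 2 * Derive f s * accel s
                 + C * (f s ^ 2 + Derive f s ^ 2)) * exp (C * s))); [lra| |].
    - intros s Hs.
      assert (D1 := profile_derive s ltac:(lra)).
      assert (D2 := profile_derive2 s ltac:(lra)).
      auto_derive; [repeat split; [eexists; exact D1|eexists; exact D2]|].
      change (Derive (fun x => Derive f x) s) with (Derive (Derive f) s).
  rewrite (is_derive_unique (Derive f) s _ D2).
      change (Derive (fun x => f x) s) with (Derive f s). ring.
    - intros s Hs. apply Rmult_le_pos; [|left; apply exp_pos].
      unfold accel. set (x := f s). set (y := Derive f s).
      assert (P : Rabs (phi gamma (alpha * x + s * y)) <= alpha * Rabs x + s * Rabs y).
      { eapply Rle_trans; [apply phi_abs_le, gamma_bounds|].
        eapply Rle_trans; [apply Rabs_triang|].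
        rewrite !Rabs_mult, (Rabs_pos_eq alpha), (Rabs_pos_eq s) by lra. lra. }
      set (w := phi gamma (alpha * x + s * y)) in *.
      assert (Q : 2 * (Rabs y * Rabs w) <= alpha * (x ^ 2 + y ^ 2) + 2 * eta * y ^ 2).
      { assert (Rabs y * Rabs w <= Rabs y * (alpha * Rabs x + s * Rabs y))
          by (apply Rmult_le_compat_l; [apply Rabs_pos|exact P]).
        assert (Rabs x * Rabs x = x ^ 2) by (rewrite <- Rabs_mult, Rabs_pos_eq; nra).
        assert (Rabs y * Rabs y = y ^ 2) by (rewrite <- Rabs_mult, Rabs_pos_eq; nra).
        assert (2 * (Rabs x * Rabs y) <= x ^ 2 + y ^ 2)
          by (assert (T := pow2_ge_0 (Rabs x - Rabs y)); nra).
        assert (0 <= y ^ 2) by apply pow2_ge_0. nra. }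
      rewrite <- Rabs_mult in Q.
      assert (Q1 := Rle_abs (y * w)).
      assert (K : (INR N - 1) / s <= (INR N - 1) / e).
      { unfold Rdiv; apply Rmult_le_compat_l; [lra|]. apply Rinv_le_contravar; lra. }
      assert (0 <= (INR N - 1) / s).
      { apply Rdiv_le_0_compat; lra. }
      assert (K2 : (INR N - 1) / s * y ^ 2 <= (INR N - 1) / e * (x ^ 2 + y ^ 2)).
      { assert (0 <= x ^ 2) by apply pow2_ge_0. assert (0 <= y ^ 2) by apply pow2_ge_0. nra. }
      assert (T := pow2_ge_0 (x + y)). assert (T2 := pow2_ge_0 x).
      unfold C. nra. }
  assert (Z : f eta ^ 2 + Derive f eta ^ 2 <= 0) by lra.
  destruct (Hd e ltac:(lra)) as [Hf _]. apply Rabs_def2 in Hf.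
  assert (0 < f e ^ 2 + Derive f e ^ 2)
    by (assert (T := pow2_ge_0 (Derive f e)); nra).
  assert (P1 := exp_pos (C * e)). assert (P2 := exp_pos (C * eta)). nra.
Qed.

(** The bracket is the derivative of [eta^(N-1) * f' + K * eta^N * f] divided by
    [eta^(N-1)], see [profile_flux_derive]; its limit at 0 is computed from [f -> 1] and
    [f' -> 0] alone. *)
Lemma profile_bracket_near_zero K gap :
  0 < gap -> exists d, 0 < d /\ forall t, 0 < t < d ->
    Rabs (INR N * K * f t + K * t * Derive f t
          - phi gamma (alpha * f t + t * Derive f t)
          - (INR N * K - phi gamma alpha)) < gap.
Proof.
  intros Hgap.
  assert (N1 := INR_ge1 N N_ge1).
  set (C := alpha + 1 + INR N * Rabs K + Rabs K).
  assert (K0 := Rabs_pos K).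
  assert (HC : 0 < C) by (unfold C; nra).
  destruct (profile_near_zero (gap / C)) as [d [dp Hd]].
  { apply Rdiv_lt_0_compat; assumption. }
  exists (Rmin 1 d); split; [apply Rmin_glb_lt; lra|].
  intros t Ht.
  assert (M1 := Rmin_l 1 d). assert (M2 := Rmin_r 1 d).
  destruct (Hd t ltac:(lra)) as [Hf Hdf].
  set (x := f t) in *. set (y := Derive f t) in *. set (eps := gap / C) in *.
  replace (INR N * K * x + K * t * y - phi gamma (alpha * x + t * y)
           - (INR N * K - phi gamma alpha))
    with (INR N * K * (x - 1) + K * t * y
          + - (phi gamma (alpha * x + t * y) - phi gamma alpha)) by ring.
  assert (P := phi_lipschitz gamma alpha (alpha * x + t * y) gamma_bounds).
  replace (alpha * x + t * y - alpha) with (alpha * (x - 1) + t * y) in P by ring.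
  assert (P2 := Rabs_triang (alpha * (x - 1)) (t * y)).
  rewrite !Rabs_mult, (Rabs_pos_eq alpha), (Rabs_pos_eq t) in P2 by lra.
  assert (E : gap = (alpha + INR N * Rabs K) * eps + (1 + Rabs K) * eps).
  { unfold eps. transitivity (C * (gap / C)); [field; lra|unfold C; ring]. }
  assert (ty : t * Rabs y < eps) by (assert (T := Rabs_pos y); nra).
  eapply Rle_lt_trans; [apply Rabs_triang|].
  eapply Rle_lt_trans; [apply Rplus_le_compat_r, Rabs_triang|].
  rewrite Rabs_Ropp, !Rabs_mult, (Rabs_pos_eq (INR N)), (Rabs_pos_eq t) by lra.
  assert (INR N * Rabs K * Rabs (x - 1) <= INR N * Rabs K * eps)
    by (apply Rmult_le_compat_l; [nra|lra]).
  assert (alpha * Rabs (x - 1) < alpha * eps) by (apply Rmult_lt_compat_l; lra).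
  assert (Rabs K * (t * Rabs y) <= Rabs K * eps) by (apply Rmult_le_compat_l; lra).
  rewrite Rmult_assoc. nra.
Qed.

(** The weight [t ^ (N - 1)] is the integrating factor that removes the singular term
    [(N - 1) / t * f']. *)
Lemma profile_flux_derive K t :
  0 < t ->
  is_derive (fun s => s ^ (N - 1) * Derive f s + K * s ^ N * f s) t
    (t ^ (N - 1) * (INR N * K * f t + K * t * Derive f t
                    - phi gamma (alpha * f t + t * Derive f t))).
Proof.
  intros Ht.
  assert (D1 := profile_derive t Ht). assert (D2 := profile_derive2 t Ht).
  auto_derive; [repeat split; [eexists; exact D2|eexists; exact D1]|].
  change (Derive (fun x => Derive f x) t) with (Derive (Derive f) t).
  rewrite (is_derive_unique (Derive f) t _ D2).
  change (Derive (fun x => f x) t) with (Derive f t). unfold accel.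
  destruct N as [|[|p]]; [lia| |].
  - simpl. field. lra.
  - simpl Nat.sub. rewrite !S_INR. simpl. field. lra.
Qed.

Lemma profile_flux_small K eps :
  0 < eps -> exists d, 0 < d /\ forall s, 0 < s < d ->
    Rabs (s ^ (N - 1) * Derive f s + K * s ^ N * f s) < eps.
Proof.
  intros He. assert (K0 := Rabs_pos K).
  set (e1 := Rmin 1 (eps / (1 + 2 * Rabs K))).
  assert (0 < eps / (1 + 2 * Rabs K)) by (apply Rdiv_lt_0_compat; lra).
  assert (He1 : 0 < e1 <= 1 /\ e1 <= eps / (1 + 2 * Rabs K)).
  { unfold e1. split; [split|]; [apply Rmin_glb_lt; lra|apply Rmin_l|apply Rmin_r]. }
  destruct (profile_near_zero e1) as [d [dp Hd]]; [lra|].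
  exists (Rmin e1 d); split; [apply Rmin_glb_lt; lra|].
  intros s Hs. assert (M1 := Rmin_l e1 d). assert (M2 := Rmin_r e1 d).
  destruct (Hd s ltac:(lra)) as [Hf Hdf].
  assert (Pw : 0 <= s ^ (N - 1) <= 1).
  { split; [apply pow_le; lra|]. rewrite <- (pow1 (N - 1)). apply pow_incr; lra. }
  replace N with (S (N - 1)) at 2 by lia. simpl pow.
  replace (s ^ (N - 1) * Derive f s + K * (s * s ^ (N - 1)) * f s)
    with (s ^ (N - 1) * (Derive f s + K * (s * f s))) by ring.
  rewrite Rabs_mult, (Rabs_pos_eq (s ^ (N - 1))) by lra.
  assert (B : Rabs (Derive f s + K * (s * f s)) < eps).
  { eapply Rle_lt_trans; [apply Rabs_triang|].
    rewrite !Rabs_mult, (Rabs_pos_eq s) by lra.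
    assert (Rabs (f s) <= 2) by (apply Rabs_def2 in Hf; apply Rabs_le; lra).
    assert (s * Rabs (f s) <= 2 * e1) by (assert (T := Rabs_pos (f s)); nra).
    assert (Rabs K * (s * Rabs (f s)) <= Rabs K * (2 * e1))
      by (apply Rmult_le_compat_l; lra).
    assert ((1 + 2 * Rabs K) * e1 <= eps).
    { replace eps with ((1 + 2 * Rabs K) * (eps / (1 + 2 * Rabs K))) by (field; lra).
      apply Rmult_le_compat_l; lra. }
    nra. }
  assert (T := Rabs_pos (Derive f s + K * (s * f s))). nra.
Qed.

(** The flux [t^(N-1) * f' + K * t^N * f] vanishes at 0 and is increasing near 0 when
    [N * K] exceeds [phi alpha]. *)
Lemma profile_slope_lower K :
  phi gamma alpha < INR N * K ->
  exists d, 0 < d /\ forall t, 0 < t < d -> 0 < Derive f t + K * t * f t.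
Proof.
  intros HK.
  destruct (profile_bracket_near_zero K (INR N * K - phi gamma alpha)) as [d [dp Hd]]; [lra|].
  exists d; split; [exact dp|]. intros t Ht.
  assert (P : 0 < t ^ (N - 1) * Derive f t + K * t ^ N * f t).
  { apply (positive_of_increasing_from_zero
      (fun s => s ^ (N - 1) * Derive f s + K * s ^ N * f s)
      (fun t => t ^ (N - 1) * (INR N * K * f t + K * t * Derive f t
                    - phi gamma (alpha * f t + t * Derive f t))) d).
    - intros s Hs; apply profile_flux_derive; lra.
    - intros s Hs. apply Rmult_lt_0_compat; [apply pow_lt; lra|].
      specialize (Hd s Hs). apply Rabs_def2 in Hd. lra.
    - intros eps He; apply profile_flux_small, He.
    - exact Ht. }
  assert (E : t ^ N = t * t ^ (N - 1)) by (replace N with (S (N - 1)) at 1 by lia; reflexivity).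
  rewrite E in P.
  assert (0 < t ^ (N - 1)) by (apply pow_lt; lra).
  apply (Rmult_lt_reg_l (t ^ (N - 1))); [assumption|]. nra.
Qed.

Lemma profile_slope_upper K :
  INR N * K < phi gamma alpha ->
  exists d, 0 < d /\ forall t, 0 < t < d -> Derive f t + K * t * f t < 0.
Proof.
  intros HK.
  destruct (profile_bracket_near_zero K (phi gamma alpha - INR N * K)) as [d [dp Hd]]; [lra|].
  exists d; split; [exact dp|]. intros t Ht.
  assert (P : 0 < - (t ^ (N - 1) * Derive f t + K * t ^ N * f t)).
  { apply (positive_of_increasing_from_zero
      (fun s => - (s ^ (N - 1) * Derive f s + K * s ^ N * f s))
      (fun t => - (t ^ (N - 1) * (INR N * K * f t + K * t * Derive f t
                    - phi gamma (alpha * f t + t * Derive f t)))) d).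
    - intros s Hs; apply @is_derive_opp, profile_flux_derive; lra.
    - intros s Hs. rewrite Ropp_mult_distr_r.
      apply Rmult_lt_0_compat; [apply pow_lt; lra|].
      specialize (Hd s Hs). apply Rabs_def2 in Hd. lra.
    - intros eps He. destruct (profile_flux_small K eps He) as [d' [dp' Hd']].
      exists d'; split; [exact dp'|]. intros s Hs. rewrite Rabs_Ropp. auto.
    - exact Ht. }
  assert (E : t ^ N = t * t ^ (N - 1)) by (replace N with (S (N - 1)) at 1 by lia; reflexivity).
  rewrite E in P.
  assert (0 < t ^ (N - 1)) by (apply pow_lt; lra).
  apply (Rmult_lt_reg_l (t ^ (N - 1))); [assumption|]. nra.
Qed.

Definition angular_speed (eta : R) : R :=
  (Derive f eta ^ 2 - f eta * accel eta) / (f eta ^ 2 + Derive f eta ^ 2).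

Lemma angular_speed_continuous eta : 0 < eta -> continuity_pt angular_speed eta.
Proof.
  intros H.
  assert (C1 := is_derive_continuity_pt _ _ _ (profile_derive eta H)).
  assert (C2 := is_derive_continuity_pt _ _ _ (profile_derive2 eta H)).
  assert (Cid : continuity_pt (fun t => t) eta) by apply derivable_continuous_pt, derivable_pt_id.
  assert (Cc : forall c, continuity_pt (fun _ => c) eta)
    by (intros c; apply derivable_continuous_pt, derivable_pt_const).
  assert (Cw : continuity_pt (fun t => alpha * f t + t * Derive f t) eta).
  { apply (continuity_pt_plus (fun t => alpha * f t) (fun t => t * Derive f t)).
    - apply (continuity_pt_mult (fun _ => alpha) f); auto.
    - apply (continuity_pt_mult (fun t => t) (Derive f)); auto. }
  assert (Cp : continuity_pt (fun t => phi gamma (alpha * f t + t * Derive f t)) eta).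
  { unfold phi.
    apply (continuity_pt_minus (fun t => (alpha * f t + t * Derive f t) / 2)
      (fun t => gamma / 2 * Rabs (alpha * f t + t * Derive f t))).
    - apply (continuity_pt_mult (fun t => alpha * f t + t * Derive f t) (fun _ => / 2)); auto.
    - apply (continuity_pt_mult (fun _ => gamma / 2)); auto.
      apply (continuity_pt_comp (fun t => alpha * f t + t * Derive f t) Rabs); auto.
      apply Rcontinuity_abs. }
  assert (Cs : continuity_pt accel eta).
  { unfold accel.
    apply (continuity_pt_minus (fun t => - ((INR N - 1) / t * Derive f t))
      (fun t => phi gamma (alpha * f t + t * Derive f t))); auto.
    apply (continuity_pt_opp (fun t => (INR N - 1) / t * Derive f t)).
    apply (continuity_pt_mult (fun t => (INR N - 1) / t) (Derive f)); auto.
    apply (continuity_pt_div (fun _ => INR N - 1) (fun t => t)); auto; lra. }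
  assert (Csq : forall g, continuity_pt g eta -> continuity_pt (fun t => g t ^ 2) eta).
  { intros g Hg. simpl. apply (continuity_pt_mult g (fun t => g t * 1)); auto.
    apply (continuity_pt_mult g (fun _ => 1)); auto. }
  unfold angular_speed.
  apply (continuity_pt_div (fun t => Derive f t ^ 2 - f t * accel t)
    (fun t => f t ^ 2 + Derive f t ^ 2)).
  - apply (continuity_pt_minus (fun t => Derive f t ^ 2) (fun t => f t * accel t)); auto.
    apply (continuity_pt_mult f accel); auto.
  - apply (continuity_pt_plus (fun t => f t ^ 2) (fun t => Derive f t ^ 2)); auto.
  - assert (T := profile_energy_pos eta H). lra.
Qed.

(** The lifted angle is defined as a primitive of its speed, which avoids any
    discussion of branches of the arctangent. *)
Lemma angular_speed_primitive e c :
  0 < e ->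
  exists th : R -> R, th e = c /\ forall t, 0 < t -> is_derive th t (angular_speed t).
Proof.
  intros He.
  exists (fun t => c + RInt angular_speed e t). split.
  { rewrite RInt_point. unfold zero; simpl. ring. }
  intros t Ht.
  assert (Hint : forall x, 0 < x -> ex_RInt angular_speed e x).
  { intros x Hx. apply (ex_RInt_continuous (V:=R_CompleteNormedModule)). intros z Hz.
    apply continuity_pt_filterlim, angular_speed_continuous.
    assert (0 < Rmin e x) by (apply Rmin_glb_lt; assumption). lra. }
  replace (angular_speed t) with (plus zero (angular_speed t)) by (unfold plus, zero; simpl; ring).
  apply (is_derive_plus (fun _ => c) (RInt angular_speed e) t zero (angular_speed t));
    [exact (is_derive_const c t)|].
  apply (is_derive_RInt angular_speed _ e t).
  - exists (mkposreal t Ht). intros y Hy.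
    apply (RInt_correct (V:=R_CompleteNormedModule)), Hint.
    change (Rabs (y - t) < t) in Hy. apply Rabs_def2 in Hy. lra.
  - apply continuity_pt_filterlim, angular_speed_continuous, Ht.
Qed.

(** The quantity [G = f cos th - f' sin th] satisfies [G' = k G] while
    [E = f^2 + f'^2] satisfies [E' = 2 k E], so [G / sqrt E] is constant.  It is 1
    at e, hence everywhere, which says that the vector [(f, - f')] has length G and
    direction th. *)
Lemma polar_form (th : R -> R) (e : R) :
  0 < e -> 0 < f e -> th e = atan (- Derive f e / f e) ->
  (forall t, 0 < t -> is_derive th t (angular_speed t)) ->
  forall t, 0 < t -> exists r, 0 < r /\
    f t = r * cos (th t) /\ Derive f t = - (r * sin (th t)).
Proof.
  intros He fe the Hth.
  set (E := fun t => f t ^ 2 + Derive f t ^ 2).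
  set (G := fun t => f t * cos (th t) - Derive f t * sin (th t)).
  set (k := fun t => Derive f t * (f t + accel t) / E t).
  assert (Epos : forall t, 0 < t -> 0 < E t) by apply profile_energy_pos.
  assert (dE : forall t, 0 < t -> is_derive E t (2 * k t * E t)).
  { intros t Ht. assert (D1 := profile_derive t Ht). assert (D2 := profile_derive2 t Ht).
    unfold E. auto_derive; [repeat split; [eexists; exact D1|eexists; exact D2]|].
    change (Derive (fun x => Derive f x) t) with (Derive (Derive f) t).
    rewrite (is_derive_unique (Derive f) t _ D2).
    change (Derive (fun x => f x) t) with (Derive f t).
    unfold k, E. field. assert (T := Epos t Ht). unfold E in T. lra. }
  assert (dG : forall t, 0 < t -> is_derive G t (k t * G t)).
  { intros t Ht. assert (D1 := profile_derive t Ht). assert (D2 := profile_derive2 t Ht).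
    assert (D3 := Hth t Ht).
    unfold G. auto_derive;
      [repeat split; [eexists; exact D1|eexists; exact D3|eexists; exact D2|eexists; exact D3]|].
    change (Derive (fun x => Derive f x) t) with (Derive (Derive f) t).
    rewrite (is_derive_unique (Derive f) t _ D2).
    change (Derive (fun x => th x) t) with (Derive th t).
    rewrite (is_derive_unique th t _ D3).
    change (Derive (fun x => f x) t) with (Derive f t).
    unfold k, E, angular_speed. field. assert (T := Epos t Ht). unfold E in T. lra. }
  assert (GE : G e = sqrt (E e)).
  { symmetry.
    assert (C : 0 < cos (th e)) by (rewrite the; apply cos_atan_pos).
    assert (S : sin (th e) = - Derive f e / f e * cos (th e))
      by (rewrite the; apply sin_atan_cos).
    assert (T := sin2_cos2 (th e)). unfold Rsqr in T.
    assert (Ge : G e = E e / f e * cos (th e)).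
    { unfold G, E. rewrite S. field. lra. }
    assert (EC : E e * (cos (th e) * cos (th e)) = f e * f e).
    { replace (f e * f e) with (f e * f e * (sin (th e) * sin (th e) + cos (th e) * cos (th e)))
        by (rewrite T; ring).
      unfold E. rewrite S. field. lra. }
    apply sqrt_lem_1.
    - left; apply Epos, He.
    - rewrite Ge. apply Rmult_le_pos; [|lra]. apply Rdiv_le_0_compat; [|lra].
      left; apply Epos, He.
    - rewrite Ge.
      replace (E e / f e * cos (th e) * (E e / f e * cos (th e)))
        with (E e * (E e * (cos (th e) * cos (th e))) / (f e * f e)) by (field; lra).
      rewrite EC. field. lra. }
  assert (Hcst : forall t, 0 < t -> is_derive (fun s => G s / sqrt (E s)) t 0).
  { intros t Ht. assert (D1 := dG t Ht). assert (D2 := dE t Ht). assert (P := Epos t Ht).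
    assert (Q := sqrt_lt_R0 _ P).
    auto_derive; [repeat split; [eexists; exact D1|eexists; exact D2|exact P|lra]|].
    change (Derive (fun x => G x) t) with (Derive G t).
    change (Derive (fun x => E x) t) with (Derive E t).
    rewrite (is_derive_unique G t _ D1), (is_derive_unique E t _ D2).
    assert (Sq : E t = sqrt (E t) * sqrt (E t)) by (symmetry; apply sqrt_sqrt; lra).
    set (q := sqrt (E t)) in *. rewrite Sq. field. lra. }
  intros t Ht.
  assert (Gt : G t = sqrt (E t)).
  { assert (R1 : G t / sqrt (E t) = G e / sqrt (E e)).
    { destruct (Rle_dec t e).
      - apply (constant_of_derive_zero (fun s => G s / sqrt (E s))); [lra|].
        intros s Hs; apply Hcst; lra.
      - symmetry. apply (constant_of_derive_zero (fun s => G s / sqrt (E s))); [lra|].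
        intros s Hs; apply Hcst; lra. }
    assert (Q := sqrt_lt_R0 _ (Epos t Ht)). assert (Q' := sqrt_lt_R0 _ (Epos e He)).
    rewrite GE in R1. unfold Rdiv in R1 at 2. rewrite Rinv_r in R1 by lra.
    apply (Rmult_eq_reg_r (/ sqrt (E t))); [|apply Rinv_neq_0_compat; lra].
    rewrite Rinv_r by lra. exact R1. }
  assert (P := Epos t Ht). assert (Q := sqrt_lt_R0 _ P).
  assert (T := sin2_cos2 (th t)). unfold Rsqr in T.
  assert (H0 : f t * sin (th t) + Derive f t * cos (th t) = 0).
  { assert (Sq : G t * G t = E t) by (rewrite Gt; apply sqrt_sqrt; lra).
    unfold G, E in Sq. apply Rsqr_0_uniq. unfold Rsqr.
    set (s := sin (th t)) in *. set (c := cos (th t)) in *.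
    set (x := f t) in *. set (y := Derive f t) in *.
    replace ((x * s + y * c) * (x * s + y * c))
      with ((x ^ 2 + y ^ 2) * (s * s + c * c) - (x * c - y * s) * (x * c - y * s)) by ring.
    rewrite T, Sq. ring. }
  exists (G t). split; [lra|]. unfold G. split.
  - transitivity (f t * (sin (th t) * sin (th t) + cos (th t) * cos (th t)));
      [rewrite T; ring|].
    replace (f t * (sin (th t) * sin (th t) + cos (th t) * cos (th t)))
      with ((f t * sin (th t) + Derive f t * cos (th t)) * sin (th t)
            + (f t * cos (th t) - Derive f t * sin (th t)) * cos (th t)) by ring.
    rewrite H0. ring.
  - transitivity (Derive f t * (sin (th t) * sin (th t) + cos (th t) * cos (th t)));
      [rewrite T; ring|].
    replace (Derive f t * (sin (th t) * sin (th t) + cos (th t) * cos (th t)))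
      with ((f t * sin (th t) + Derive f t * cos (th t)) * cos (th t)
            - (f t * cos (th t) - Derive f t * sin (th t)) * sin (th t)) by ring.
    rewrite H0. ring.
Qed.

Lemma angle_exists : exists theta, is_angle N gamma alpha f theta.
Proof.
  destruct (profile_near_zero (1 / 2)) as [d [dp Hd]]; [lra|].
  assert (fpos : forall t, 0 < t < d -> 0 < f t).
  { intros t Ht. destruct (Hd t Ht) as [Hf _]. apply Rabs_def2 in Hf. lra. }
  set (e := d / 2). assert (He : 0 < e < d) by (unfold e; lra).
  destruct (angular_speed_primitive e (atan (- Derive f e / f e)) (proj1 He))
    as [th [the Hth]].
  assert (Hpol := polar_form th e (proj1 He) (fpos e He) the Hth).
  (* While f is positive the lifted angle is the principal one: both have the same
     derivative and agree at e. *)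
  assert (Hat : forall t, 0 < t <= e -> th t = atan (- Derive f t / f t)).
  { intros t Ht.
    assert (K : th t - atan (- Derive f t / f t) = th e - atan (- Derive f e / f e)).
    { apply (constant_of_derive_zero (fun s => th s - atan (- Derive f s / f s))); [lra|].
      intros s Hs. assert (D1 := profile_derive s ltac:(lra)).
      assert (D2 := profile_derive2 s ltac:(lra)). assert (D3 := Hth s ltac:(lra)).
      assert (fs := fpos s ltac:(lra)).
      auto_derive; [repeat split;
        [eexists; exact D3|eexists; exact D2|eexists; exact D1|lra]|].
      change (Derive (fun x => Derive f x) s) with (Derive (Derive f) s).
      change (Derive (fun x => th x) s) with (Derive th s).
      rewrite (is_derive_unique (Derive f) s _ D2), (is_derive_unique th s _ D3).
      change (Derive (fun x => f x) s) with (Derive f s).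
      unfold angular_speed. assert (T := profile_energy_pos s ltac:(lra)).
      field. split; nra. }
    rewrite the in K. lra. }
  exists th. split; [|split; [exact Hpol|split]].
  - intros t Ht. replace (slope N gamma alpha t (th t)) with (angular_speed t); [apply Hth, Ht|].
    destruct (Hpol t Ht) as [r [rp [Ef Edf]]].
    unfold angular_speed, slope, accel. rewrite Ef, Edf.
    set (s := sin (th t)). set (c := cos (th t)).
    replace (alpha * (r * c) + t * - (r * s)) with (r * (alpha * c - t * s)) by ring.
    rewrite phi_scale by lra.
    replace ((r * c) ^ 2 + (- (r * s)) ^ 2) with (r ^ 2).
    + field. split; lra.
    + assert (T := sin2_cos2 (th t)). unfold Rsqr in T. fold s c in T.
      transitivity (r ^ 2 * (s * s + c * c)); [rewrite T; ring|ring].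
  - intros K HK. destruct (profile_slope_upper K HK) as [d' [dp' H']].
    exists (Rmin e d'). split; [apply Rmin_glb_lt; lra|].
    intros t Ht. assert (M1 := Rmin_l e d'). assert (M2 := Rmin_r e d').
    rewrite Hat by lra. apply atan_increasing.
    specialize (H' t ltac:(lra)). assert (fs := fpos t ltac:(lra)).
    apply (Rmult_lt_reg_r (f t)); [exact fs|].
    replace (- Derive f t / f t * f t) with (- Derive f t) by (field; lra). lra.
  - intros K HK. destruct (profile_slope_lower K HK) as [d' [dp' H']].
    exists (Rmin e d'). split; [apply Rmin_glb_lt; lra|].
    intros t Ht. assert (M1 := Rmin_l e d'). assert (M2 := Rmin_r e d').
    rewrite Hat by lra. apply atan_increasing.
    specialize (H' t ltac:(lra)). assert (fs := fpos t ltac:(lra)).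
    apply (Rmult_lt_reg_r (f t)); [exact fs|].
    replace (- Derive f t / f t * f t) with (- Derive f t) by (field; lra). lra.
Qed.

End Profile.

(** * The flow of the angle equation *)

(** On the branch of index n, with [T = tan theta], the slope is
    [T' / (1 + T^2)] where T solves a Riccati equation; homogeneity of phi takes the
    cosine out. *)
Lemma slope_branch N gamma alpha eta n T :
  slope N gamma alpha eta (INR n * PI + atan T) =
  (T ^ 2 - (INR N - 1) / eta * T + phi ((-1) ^ n * gamma) (alpha - eta * T)) / (1 + T ^ 2).
Proof.
  unfold slope. rewrite cos_add_nPI, sin_add_nPI, sin_atan_cos.
  assert (P := cos_atan_pos T). assert (Sq := cos_atan_sqr T).
  set (C := cos (atan T)) in *.
  replace (alpha * ((-1) ^ n * C) - eta * ((-1) ^ n * (T * C)))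
    with (C * ((-1) ^ n * (alpha - eta * T))) by ring.
  rewrite phi_scale by lra. rewrite <- phi_branch.
  set (p := phi gamma ((-1) ^ n * (alpha - eta * T))).
  assert (Q : 0 < 1 + T ^ 2) by (assert (Z := pow2_ge_0 T); lra).
  assert (S1 : (-1) ^ n * (-1) ^ n = 1)
    by (destruct (pow_neg1_cases n) as [->| ->]; ring).
  apply (Rmult_eq_reg_r (1 + T ^ 2)); [|lra].
  set (k := (INR N - 1) / eta). set (m := (-1) ^ n) in *.
  replace ((T ^ 2 - k * T + m * p) / (1 + T ^ 2) * (1 + T ^ 2)) with (T ^ 2 - k * T + m * p)
    by (field; lra).
  replace (((m * (T * C)) ^ 2 - k * (m * (T * C) * (m * C)) + m * C * (C * p)) * (1 + T ^ 2))
    with ((C ^ 2 * (1 + T ^ 2)) * ((m * m) * (T ^ 2 - k * T) + m * p)) by ring.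
  rewrite Sq, S1. ring.
Qed.

Lemma slope_node N gamma alpha eta x : cos x = 0 -> slope N gamma alpha eta x = 1.
Proof.
  intros H. assert (T := sin2_cos2 x). unfold slope, Rsqr in *. rewrite H in *. nra.
Qed.

(** The part of the slope that stays Lipschitz down to [eta = 0].  The remaining part,
    [- (N - 1) / eta * sin (2 theta) / 2], is singular but dissipative for small
    angles. *)
Definition drift (gamma alpha eta theta : R) : R :=
  sin theta ^ 2 + cos theta * phi gamma (alpha * cos theta - eta * sin theta).

Lemma slope_drift N gamma alpha eta theta :
  slope N gamma alpha eta theta =
  drift gamma alpha eta theta - (INR N - 1) / eta * (sin (2 * theta) / 2).
Proof. unfold slope, drift. rewrite sin_2a. unfold Rdiv. ring_simplify. lra. Qed.

Lemma drift_lipschitz gamma alpha eta x y :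
  -1 < gamma < 1 -> 0 <= alpha -> 0 <= eta ->
  Rabs (drift gamma alpha eta y - drift gamma alpha eta x)
    <= (2 + 2 * (alpha + eta)) * Rabs (y - x).
Proof.
  intros Hg Ha He. unfold drift.
  set (p := fun t => phi gamma (alpha * cos t - eta * sin t)).
  change (phi gamma (alpha * cos y - eta * sin y)) with (p y).
  change (phi gamma (alpha * cos x - eta * sin x)) with (p x).
  assert (Ls := sin_lipschitz x y). assert (Lc := cos_lipschitz x y).
  assert (Sx : Rabs (sin x) <= 1) by (apply Rabs_le, SIN_bound).
  assert (Sy : Rabs (sin y) <= 1) by (apply Rabs_le, SIN_bound).
  assert (Cx : Rabs (cos x) <= 1) by (apply Rabs_le, COS_bound).
  assert (Cy : Rabs (cos y) <= 1) by (apply Rabs_le, COS_bound).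
  set (d := Rabs (y - x)) in *.
  assert (Pb : Rabs (p x) <= alpha + eta).
  { unfold p. eapply Rle_trans; [apply phi_abs_le, Hg|].
    unfold Rminus. eapply Rle_trans; [apply Rabs_triang|].
    rewrite Rabs_Ropp, !Rabs_mult, (Rabs_pos_eq alpha), (Rabs_pos_eq eta) by lra. nra. }
  assert (Pl : Rabs (p y - p x) <= (alpha + eta) * d).
  { unfold p. eapply Rle_trans; [apply phi_lipschitz, Hg|].
    replace (alpha * cos y - eta * sin y - (alpha * cos x - eta * sin x))
      with (alpha * (cos y - cos x) + - (eta * (sin y - sin x))) by ring.
    eapply Rle_trans; [apply Rabs_triang|].
    rewrite Rabs_Ropp, !Rabs_mult, (Rabs_pos_eq alpha), (Rabs_pos_eq eta) by lra. nra. }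
  replace (sin y ^ 2 + cos y * p y - (sin x ^ 2 + cos x * p x))
    with ((sin y - sin x) * (sin y + sin x)
          + ((cos y - cos x) * p x + cos y * (p y - p x))) by ring.
  assert (P0 := Rabs_pos (y - x)). fold d in P0.
  eapply Rle_trans; [apply Rabs_triang|].
  eapply Rle_trans; [apply Rplus_le_compat_l, Rabs_triang|].
  rewrite !Rabs_mult.
  assert (S2 : Rabs (sin y + sin x) <= 2)
    by (eapply Rle_trans; [apply Rabs_triang|]; lra).
  assert (Rabs (sin y - sin x) * Rabs (sin y + sin x) <= d * 2)
    by (apply Rmult_le_compat; auto; apply Rabs_pos).
  assert (Rabs (cos y - cos x) * Rabs (p x) <= d * (alpha + eta))
    by (apply Rmult_le_compat; auto; apply Rabs_pos).
  assert (Rabs (cos y) * Rabs (p y - p x) <= 1 * ((alpha + eta) * d))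
    by (apply Rmult_le_compat; auto; apply Rabs_pos).
  nra.
Qed.

(** Increasing alpha moves the argument of phi in the direction of the sign of the
    cosine, so the product with the cosine never decreases. *)
Lemma drift_increments gamma alpha beta eta x :
  -1 < gamma < 1 -> alpha <= beta ->
  0 <= drift gamma beta eta x - drift gamma alpha eta x <= beta - alpha.
Proof.
  intros Hg Hab. unfold drift.
  assert (B := COS_bound x). set (c := cos x) in *. set (s := eta * sin x).
  destruct (Rle_dec 0 c).
  - assert (P := phi_increments gamma (alpha * c - s) (beta * c - s) Hg ltac:(nra)). nra.
  - assert (P := phi_increments gamma (beta * c - s) (alpha * c - s) Hg ltac:(nra)). nra.
Qed.

Section Flow.

Context (N : nat) (gamma : R).
Hypothesis N_ge1 : (1 <= N)%nat.
Hypothesis gamma_bounds : -1 < gamma < 1.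

(** At an angle with zero cosine the slope is 1, so such a value is reached at most once
    and never left downwards. *)
Lemma angle_upcrossing alpha f th x s t :
  is_angle N gamma alpha f th -> cos x = 0 ->
  0 < s < t -> x <= th s -> x < th t.
Proof.
  intros (Hd & _) Hx Hst Hs.
  enough (0 < th t - x) by lra.
  apply (positive_of_barrier_at_zero (fun u => th u - x)
    (fun u => slope N gamma alpha u (th u)) s t); [lra| | |lra].
  - intros u Hu. assert (D := Hd u ltac:(lra)).
    auto_derive; [eexists; exact D|].
    change (Derive (fun y => th y) u) with (Derive th u).
    rewrite (is_derive_unique th u _ D). ring.
  - intros u Hu E. rewrite slope_node; [lra|]. replace (th u) with x by lra. exact Hx.
Qed.

(** At [theta = 0] the slope is [phi alpha > 0]. *)
Lemma angle_positive alpha f th t :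
  0 < alpha -> is_angle N gamma alpha f th -> 0 < t -> 0 < th t.
Proof.
  intros Ha (Hd & _ & Hl & _) Ht.
  assert (Hp := phi_alpha_pos gamma alpha gamma_bounds Ha).
  destruct (Hl 0) as [d [dp H]]; [lra|].
  set (s := Rmin t (d / 2)).
  assert (Hs : 0 < s <= t /\ s < d)
    by (unfold s, Rmin; destruct (Rle_dec t (d / 2)); lra).
  apply (positive_of_barrier th (fun u => slope N gamma alpha u (th u)) s t); [lra| | |].
  - intros u Hu; apply Hd; lra.
  - intros u Hu ->. unfold slope. rewrite sin_0, cos_0.
    replace (alpha * 1 - u * 0) with alpha by ring.
    replace (0 ^ 2 - (INR N - 1) / u * (0 * 1)) with 0 by (unfold Rdiv; ring). lra.
  - specialize (H s ltac:(lra)). rewrite Rmult_0_l, atan_0 in H. exact H.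
Qed.

(** Along the curve [n PI + atan (delta u)] the difference between the slope of the
    curve and that of the flow has the sign opposite to that of the expression in the
    hypothesis, so that the flow can only cross the curve downwards. *)
Lemma angle_barrier alpha f th n delta s t :
  is_angle N gamma alpha f th ->
  0 < s <= t ->
  (forall u, s <= u <= t ->
     delta ^ 2 * u ^ 2 - INR N * delta
     + phi ((-1) ^ n * gamma) (alpha - delta * u ^ 2) < 0) ->
  th s < INR n * PI + atan (delta * s) ->
  th t < INR n * PI + atan (delta * t).
Proof.
  intros (Hd & _) Hst Hc Hs.
  enough (0 < INR n * PI + atan (delta * t) - th t) by lra.
  apply (positive_of_barrier (fun u => INR n * PI + atan (delta * u) - th u)
    (fun u => delta / (1 + (delta * u) ^ 2) - slope N gamma alpha u (th u)) s t); [lra| | |lra].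
  - intros u Hu. assert (D := Hd u ltac:(lra)).
    assert (Q := pow2_ge_0 (delta * u)).
    auto_derive; [eexists; exact D|].
    change (Derive (fun y => th y) u) with (Derive th u).
    rewrite (is_derive_unique th u _ D). field. lra.
  - intros u Hu E.
    assert (Q := pow2_ge_0 (delta * u)).
    replace (th u) with (INR n * PI + atan (delta * u)) by lra.
    rewrite slope_branch.
    replace (u * (delta * u)) with (delta * u ^ 2) by ring.
    replace ((INR N - 1) / u * (delta * u)) with ((INR N - 1) * delta) by (field; lra).
    unfold Rdiv. rewrite <- Rmult_minus_distr_r.
    apply Rmult_lt_0_compat; [|apply Rinv_0_lt_compat; lra].
    specialize (Hc u Hu). nra.
Qed.

(** For large u the argument of phi is negative and phi is linear with slope
    [c = (1 + (-1)^n gamma) / 2]; the leading term is then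
    [- delta * (c - delta) * u^2]. *)
Lemma barrier_at_infinity n delta A :
  0 < delta < (1 + (-1) ^ n * gamma) / 2 -> 0 < A ->
  exists R0, 0 < R0 /\ forall alpha u, alpha <= A -> R0 <= u ->
    delta ^ 2 * u ^ 2 - INR N * delta
    + phi ((-1) ^ n * gamma) (alpha - delta * u ^ 2) < 0.
Proof.
  intros Hd HA.
  assert (G := pow_neg1_mult n gamma gamma_bounds).
  set (g := (-1) ^ n * gamma) in *. set (c := (1 + g) / 2) in *.
  assert (Hc : 0 < c < 1) by (unfold c; lra).
  set (q := delta * (c - delta)).
  assert (Hq : 0 < q <= delta) by (unfold q; nra).
  (* u >= 1 + A / q implies q * u ^ 2 >= A, and delta * u ^ 2 >= A as q <= delta. *)
  exists (1 + A / q).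
  assert (HAq : 0 < A / q) by (apply Rdiv_lt_0_compat; lra).
  split; [lra|]. intros alpha u Ha Hu.
  assert (Hu2 : A <= q * u ^ 2).
  { assert (A / q <= u ^ 2) by nra.
    replace A with (q * (A / q)) by (field; lra).
    apply Rmult_le_compat_l; lra. }
  assert (u2 := pow2_ge_0 u). assert (N1 := INR_ge1 N N_ge1).
  rewrite phi_neg by nra. fold c.
  assert (E : q * u ^ 2 = c * delta * u ^ 2 - delta ^ 2 * u ^ 2) by (unfold q; ring).
  nra.
Qed.

Lemma angle_below_barrier alpha f th n delta R0 s t :
  is_angle N gamma alpha f th ->
  (forall u, R0 <= u -> delta ^ 2 * u ^ 2 - INR N * delta
    + phi ((-1) ^ n * gamma) (alpha - delta * u ^ 2) < 0) ->
  0 < R0 <= s -> s <= t ->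
  th s < INR n * PI + atan (delta * s) ->
  th t < INR n * PI + atan (delta * t).
Proof.
  intros Ha Hc Hs Hst H. apply (angle_barrier alpha f th n delta s t); auto; [lra|].
  intros u Hu; apply Hc; lra.
Qed.

(** Since nodes are only crossed upwards, this says that the profile has at most n zeros. *)
Definition stays_below (n : nat) (th : R -> R) : Prop :=
  forall eta, 0 < eta -> th eta < node n.

(** After s the angle is trapped under the barrier; before s it cannot have reached node
    n, as it would still be above it at s. *)
Lemma stays_below_of_barrier alpha f th n delta R0 s :
  is_angle N gamma alpha f th ->
  (forall u, R0 <= u -> delta ^ 2 * u ^ 2 - INR N * delta
    + phi ((-1) ^ n * gamma) (alpha - delta * u ^ 2) < 0) ->
  0 < R0 <= s ->
  th s < INR n * PI + atan (delta * s) ->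
  stays_below n th.
Proof.
  intros Ha Hc Hs H eta He.
  destruct (Rle_dec s eta) as [L|L].
  - eapply Rlt_trans; [|apply branch_lt_node].
    eapply (angle_below_barrier alpha f th n delta R0 s eta); eauto.
  - destruct (Rlt_dec (th eta) (node n)) as [|Hn]; [assumption|exfalso].
    assert (U := angle_upcrossing alpha f th (node n) eta s Ha (cos_node n) ltac:(lra) ltac:(lra)).
    assert (V := branch_lt_node n (delta * s)). lra.
Qed.

(** With delta the smaller of the two slopes of phi, the curve [atan (delta eta)] is a
    barrier on the whole half-line as soon as alpha is small. *)
Lemma stays_below_small alpha f th :
  0 < alpha ->
  alpha < Rmin ((1 - gamma) / 2) ((1 + gamma) / 2) ->
  is_angle N gamma alpha f th -> stays_below 0 th.
Proof.
  intros Ha Hs Hang.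
  set (delta := Rmin ((1 - gamma) / 2) ((1 + gamma) / 2)) in *.
  assert (D1 : delta <= (1 - gamma) / 2) by apply Rmin_l.
  assert (D2 : delta <= (1 + gamma) / 2) by apply Rmin_r.
  assert (N1 := INR_ge1 N N_ge1).
  assert (P := phi_alpha_pos gamma alpha gamma_bounds Ha).
  destruct Hang as (Hd & Hr & Hl & Hu).
  destruct (Hu delta) as [d [dp Hnear]]; [nra|].
  intros eta He.
  set (s := Rmin eta (d / 2)).
  assert (Hse : 0 < s <= eta /\ s < d)
    by (unfold s, Rmin; destruct (Rle_dec eta (d / 2)); lra).
  eapply Rlt_trans; [|apply (branch_lt_node 0 (delta * eta))].
  apply (angle_barrier alpha f th 0 delta s eta).
  - exact (conj Hd (conj Hr (conj Hl Hu))).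
  - lra.
  - intros u Hus. replace ((-1) ^ 0 * gamma) with gamma by (simpl; ring).
    set (v := u ^ 2). assert (Hv : 0 <= v) by apply pow2_ge_0.
    assert (dp0 : 0 < delta) by lra.
    assert (dv : 0 <= delta * v) by nra.
    assert (Nd : delta <= INR N * delta) by nra.
    destruct (Rle_dec 0 (alpha - delta * v)).
    + rewrite phi_pos by lra.
      assert (0 <= delta * v * ((1 - gamma) / 2 - delta)) by (apply Rmult_le_pos; lra).
      nra.
    + rewrite phi_neg by lra.
      assert (0 <= delta * v * ((1 + gamma) / 2 - delta)) by (apply Rmult_le_pos; lra).
      nra.
  - simpl. rewrite Rmult_0_l, Rplus_0_l. apply Hnear. lra.
Qed.

(** The orders of theta at 0 are [phi alpha / N] and [phi beta / N], so a curve
    [atan (K eta)] separates the two angles near 0; monotonicity of the slope in alpha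
    and Gronwall propagate the strict inequality. *)
Lemma angle_increasing_in_alpha alpha beta f g tha thb t :
  0 < alpha < beta ->
  is_angle N gamma alpha f tha -> is_angle N gamma beta g thb ->
  0 < t -> tha t < thb t.
Proof.
  intros Hab (Da & _ & _ & Ha) (Db & _ & Hb & _) Ht.
  assert (N1 := INR_ge1 N N_ge1).
  assert (Pa : phi gamma alpha < phi gamma beta) by (rewrite !phi_pos by lra; nra).
  set (K := (phi gamma alpha + phi gamma beta) / (2 * INR N)).
  assert (NK : INR N * K = (phi gamma alpha + phi gamma beta) / 2) by (unfold K; field; lra).
  destruct (Ha K) as [d1 [p1 H1]]; [lra|]. destruct (Hb K) as [d2 [p2 H2]]; [lra|].
  set (d := Rmin d1 d2). assert (dp : 0 < d) by (apply Rmin_glb_lt; assumption).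
  assert (M1 : d <= d1) by apply Rmin_l. assert (M2 : d <= d2) by apply Rmin_r.
  set (s := Rmin t (d / 2)).
  assert (Hs : 0 < s <= t /\ s < d)
    by (unfold s, Rmin; destruct (Rle_dec t (d / 2)); lra).
  specialize (H1 s ltac:(lra)). specialize (H2 s ltac:(lra)).
  enough (0 < thb t - tha t) by lra.
  (* L is a Lipschitz constant of the slope in theta on [s, t]. *)
  set (L := 2 + 2 * (alpha + t) + (INR N - 1) / s).
  apply (positive_of_gronwall (fun u => thb u - tha u)
    (fun u => slope N gamma beta u (thb u) - slope N gamma alpha u (tha u)) L s t);
    [lra| | |lra].
  - intros u Hu. apply @is_derive_minus; [apply Db|apply Da]; lra.
  - intros u Hu Hpos. rewrite !slope_drift.
    assert (I := drift_increments gamma alpha beta u (thb u) gamma_bounds ltac:(lra)).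
    assert (Lp := drift_lipschitz gamma alpha u (tha u) (thb u) gamma_bounds ltac:(lra) ltac:(lra)).
    assert (Sp := sin_lipschitz (2 * tha u) (2 * thb u)).
    replace (2 * thb u - 2 * tha u) with (2 * (thb u - tha u)) in Sp by ring.
    rewrite Rabs_mult, (Rabs_pos_eq 2) in Sp by lra.
    set (dth := thb u - tha u) in *.
    rewrite (Rabs_pos_eq dth) in Lp, Sp by lra.
    apply Rabs_le_between in Lp. apply Rabs_le_between in Sp.
    assert (K0 : 0 <= (INR N - 1) / u) by (apply Rdiv_le_0_compat; lra).
    assert (K1 : (INR N - 1) / u <= (INR N - 1) / s).
    { unfold Rdiv; apply Rmult_le_compat_l; [lra|]. apply Rinv_le_contravar; lra. }
    assert (Q : (INR N - 1) / u * ((sin (2 * thb u) - sin (2 * tha u)) / 2)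
                <= (INR N - 1) / s * dth).
    { apply Rle_trans with ((INR N - 1) / u * dth).
      - apply Rmult_le_compat_l; lra.
      - apply Rmult_le_compat_r; lra. }
    assert (Q2 : 2 * (alpha + u) * dth <= 2 * (alpha + t) * dth)
      by (apply Rmult_le_compat_r; lra).
    unfold L. nra.
Qed.

(** With the slope [A + 1], larger than [phi alpha] for every [alpha <= A], the
    curve [atan ((A + 1) t)] is a barrier on an interval that depends on A only. *)
Lemma angle_small_near_zero A :
  0 < A -> exists e, 0 < e /\ forall alpha f th t,
    0 < alpha <= A -> is_angle N gamma alpha f th -> 0 < t <= e ->
    th t < atan ((A + 1) * t) /\ th t < PI / 4.
Proof.
  intros HA. set (D := A + 1).
  assert (HD : 1 < D) by (unfold D; lra).
  exists (/ (2 * D)). assert (E0 : 0 < / (2 * D)) by (apply Rinv_0_lt_compat; lra).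
  split; [exact E0|].
  intros alpha f th t Ha Hang Ht.
  assert (DE : forall u, u <= / (2 * D) -> D * u <= 1 / 2).
  { intros u Hu. replace (1 / 2) with (D * / (2 * D)) by (field; lra).
    apply Rmult_le_compat_l; lra. }
  assert (N1 := INR_ge1 N N_ge1).
  assert (P := phi_alpha_pos gamma alpha gamma_bounds (proj1 Ha)).
  assert (Hb : th t < atan (D * t)).
  { assert (Hang' := Hang). destruct Hang' as (Hd & Hr & Hl & Hu).
    destruct (Hu D) as [d [dp Hnear]]; [unfold D in *; nra|].
    set (s := Rmin t (d / 2)).
    assert (Hse : 0 < s <= t /\ s < d)
      by (unfold s, Rmin; destruct (Rle_dec t (d / 2)); lra).
    replace (atan (D * t)) with (INR 0 * PI + atan (D * t)) by (simpl; ring).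
    apply (angle_barrier alpha f th 0 D s t Hang); [lra| |].
    - intros u Hus. replace ((-1) ^ 0 * gamma) with gamma by (simpl; ring).
      assert (DU := DE u ltac:(lra)).
      assert (I := phi_increments gamma (alpha - D * u ^ 2) alpha gamma_bounds
                     ltac:(nra)).
      assert (D * u * (D * u) <= 1 / 2 * (1 / 2)) by (apply Rmult_le_compat; nra).
      unfold D in *. nra.
    - simpl. rewrite Rmult_0_l, Rplus_0_l. apply Hnear. lra. }
  split; [exact Hb|].
  eapply Rlt_trans; [exact Hb|]. rewrite <- atan_1. apply atan_increasing.
  assert (DU := DE t ltac:(lra)). lra.
Qed.

(** Gronwall from [eta = 0] with a constant L that does not see the singularity: on
    [(0, e)] both angles lie in [(0, PI / 4)], where [sin (2 theta)] is increasing, so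
    the singular term contracts; beyond e its coefficient is at most [(N - 1) / e]. *)
Lemma angle_lipschitz_in_alpha A t :
  0 < A -> 0 < t ->
  exists C, 0 < C /\ forall alpha beta f g tha thb,
    0 < alpha < beta -> beta <= A ->
    is_angle N gamma alpha f tha -> is_angle N gamma beta g thb ->
    thb t - tha t <= C * (beta - alpha).
Proof.
  intros HA Ht.
  destruct (angle_small_near_zero A HA) as [e [ep He]].
  assert (N1 := INR_ge1 N N_ge1).
  set (L := 2 + 2 * (A + t) + (INR N - 1) / e).
  assert (Hk : 0 <= (INR N - 1) / e) by (apply Rdiv_le_0_compat; lra).
  assert (HL : 0 < L) by (unfold L; lra).
  exists (t * exp (L * t)).
  split; [apply Rmult_lt_0_compat; [lra|apply exp_pos]|].
  intros alpha beta f g tha thb Hab HbA Ha Hb.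
  assert (Hlt : forall u, 0 < u -> tha u < thb u)
    by (intros u Hu; eapply angle_increasing_in_alpha; eauto).
  assert (Hpos : forall u, 0 < u -> 0 < tha u)
    by (intros u Hu; apply (angle_positive alpha f); auto; lra).
  assert (Step : forall s, 0 < s <= t -> s <= e ->
    (thb t - tha t) * exp (- L * t) <= (A + 1) * s + (beta - alpha) * t).
  { intros s Hs Hse.
    assert (M : - ((thb s - tha s) * exp (- L * s) - (beta - alpha) * s)
                <= - ((thb t - tha t) * exp (- L * t) - (beta - alpha) * t)).
    { apply (nondecreasing_of_derive
        (fun u => - ((thb u - tha u) * exp (- L * u) - (beta - alpha) * u))
        (fun u => (L * (thb u - tha u)
                   - (slope N gamma beta u (thb u) - slope N gamma alpha u (tha u)))
                  * exp (- L * u) + (beta - alpha))); [lra| |].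
      - intros u Hu. assert (D1 := proj1 Ha u ltac:(lra)). assert (D2 := proj1 Hb u ltac:(lra)).
        auto_derive; [repeat split; eexists; [exact D2|exact D1]|].
        change (Derive (fun y => tha y) u) with (Derive tha u).
        change (Derive (fun y => thb y) u) with (Derive thb u).
        rewrite (is_derive_unique tha u _ D1), (is_derive_unique thb u _ D2). ring.
      - intros u Hu. specialize (Hlt u ltac:(lra)).
        set (dth := thb u - tha u) in *.
        assert (Hdth : 0 < dth) by (unfold dth; lra).
        assert (Key : slope N gamma beta u (thb u) - slope N gamma alpha u (tha u)
                      <= L * dth + (beta - alpha)).
        { rewrite !slope_drift.
          assert (I := drift_increments gamma alpha beta u (thb u) gamma_bounds ltac:(lra)).
          assert (Lp := drift_lipschitz gamma alpha u (tha u) (thb u) gamma_bounds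
                          ltac:(lra) ltac:(lra)).
          fold dth in Lp. rewrite (Rabs_pos_eq dth) in Lp by lra.
          apply Rabs_le_between in Lp.
          assert (K0 : 0 <= (INR N - 1) / u) by (apply Rdiv_le_0_compat; lra).
          assert (Q : - ((INR N - 1) / e * dth)
                      <= (INR N - 1) / u * ((sin (2 * thb u) - sin (2 * tha u)) / 2)).
          { destruct (Rle_dec u e) as [ue|ue].
            - destruct (He beta g thb u ltac:(lra) Hb ltac:(lra)) as [_ B1].
              assert (B2 := Hpos u ltac:(lra)).
              assert (sin (2 * tha u) <= sin (2 * thb u)) by (apply sin_incr_1; lra).
              assert (0 <= (INR N - 1) / u * ((sin (2 * thb u) - sin (2 * tha u)) / 2))
                by (apply Rmult_le_pos; lra).
              assert (0 <= (INR N - 1) / e * dth) by (apply Rmult_le_pos; lra). lra.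
            - assert (Sp := sin_lipschitz (2 * tha u) (2 * thb u)).
              replace (2 * thb u - 2 * tha u) with (2 * dth) in Sp by (unfold dth; ring).
              rewrite Rabs_mult, (Rabs_pos_eq 2), (Rabs_pos_eq dth) in Sp by lra.
              apply Rabs_le_between in Sp.
              assert (K1 : (INR N - 1) / u <= (INR N - 1) / e).
              { unfold Rdiv; apply Rmult_le_compat_l; [lra|]. apply Rinv_le_contravar; lra. }
              apply Rle_trans with ((INR N - 1) / u * (- dth)).
              + assert ((INR N - 1) / u * dth <= (INR N - 1) / e * dth)
                  by (apply Rmult_le_compat_r; lra). lra.
              + apply Rmult_le_compat_l; lra. }
          assert (Q2 : 2 * (alpha + u) * dth <= 2 * (A + t) * dth)
            by (apply Rmult_le_compat_r; lra).
          unfold L. nra. }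
        assert (E1 : exp (- L * u) <= 1).
        { rewrite <- exp_0. destruct (Req_dec (- L * u) 0) as [->|nz]; [lra|].
          left; apply exp_increasing. nra. }
        assert (E0 := exp_pos (- L * u)).
        nra. }
    destruct (He beta g thb s ltac:(lra) Hb ltac:(lra)) as [B1 _].
    assert (B2 := Hpos s ltac:(lra)).
    assert (At : atan ((A + 1) * s) <= (A + 1) * s).
    { apply atan_le; nra. }
    assert (E1 : exp (- L * s) <= 1).
    { rewrite <- exp_0. left; apply exp_increasing. nra. }
    assert (E0 := exp_pos (- L * s)).
    assert (0 < (beta - alpha) * s) by (apply Rmult_lt_0_compat; lra).
    assert (Hd : (thb s - tha s) * exp (- L * s) <= thb s - tha s).
    { specialize (Hlt s ltac:(lra)). nra. }
    lra. }
  (* s is arbitrarily small in Step, so its first term disappears. *)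
  assert (Lim : (thb t - tha t) * exp (- L * t) <= (beta - alpha) * t).
  { apply Rnot_lt_le. intros Hn.
    set (gap := (thb t - tha t) * exp (- L * t) - (beta - alpha) * t).
    assert (Hgap : 0 < gap) by (unfold gap; lra).
    set (s := Rmin (Rmin t e) (gap / (2 * (A + 1)))).
    assert (G2 : 0 < gap / (2 * (A + 1))) by (apply Rdiv_lt_0_compat; lra).
    assert (S1 : s <= Rmin t e) by apply Rmin_l.
    assert (S2 : s <= gap / (2 * (A + 1))) by apply Rmin_r.
    assert (S3 := Rmin_l t e). assert (S4 := Rmin_r t e).
    assert (S0 : 0 < s) by (repeat apply Rmin_glb_lt; assumption).
    specialize (Step s ltac:(lra) ltac:(lra)).
    assert ((A + 1) * s <= gap / 2).
    { replace (gap / 2) with ((A + 1) * (gap / (2 * (A + 1)))) by (field; lra).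
      apply Rmult_le_compat_l; lra. }
    unfold gap in *. lra. }
  assert (E0 := exp_pos (L * t)).
  replace (thb t - tha t) with ((thb t - tha t) * exp (- L * t) * exp (L * t)).
  - replace (t * exp (L * t) * (beta - alpha)) with ((beta - alpha) * t * exp (L * t)) by ring.
    apply Rmult_le_compat_r; lra.
  - rewrite Rmult_assoc, <- exp_plus. replace (- L * t + L * t) with 0 by ring.
    rewrite exp_0. ring.
Qed.

End Flow.

(** * Behaviour at infinity *)

(** With l the limit of f / h, k is the square of [|l| / 2] and [9 k] that of
    [3 |l| / 2]; squares make the sign of f irrelevant. *)
Lemma asymp_bounds f h :
  asymp f h -> (forall t, 0 < h t) ->
  exists k M, 0 < k /\ 0 < M /\
    forall t, M <= t -> k * h t ^ 2 <= f t ^ 2 <= 9 * k * h t ^ 2.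
Proof.
  intros [l [l0 Hl]] Hh.
  apply is_lim_spec in Hl.
  assert (lp : 0 < Rabs l) by (apply Rabs_pos_lt, l0).
  destruct (Hl (mkposreal (Rabs l / 2) ltac:(lra))) as [M HM].
  exists ((Rabs l / 2) ^ 2), (Rabs M + 1).
  assert (M0 := Rabs_pos M). assert (M1 := Rle_abs M).
  split; [apply pow_lt; lra|]. split; [lra|].
  intros t Ht. specialize (HM t ltac:(lra)). simpl in HM.
  assert (hp := Hh t).
  assert (E : f t = f t / h t * h t) by (field; lra).
  set (r := f t / h t) in *.
  assert (R1 : Rabs l / 2 <= Rabs r <= 3 * (Rabs l / 2)).
  { assert (A1 := Rabs_triang (r - l) l). replace (r - l + l) with r in A1 by ring.
    assert (A2 := Rabs_triang (l - r) r). replace (l - r + r) with l in A2 by ring.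
    rewrite (Rabs_minus_sym l r) in A2. lra. }
  rewrite E.
  replace ((r * h t) ^ 2) with (Rabs r ^ 2 * h t ^ 2)
    by (rewrite <- Rsqr_pow2, <- Rsqr_abs, Rsqr_pow2; ring).
  assert (h2 : 0 < h t ^ 2) by (apply pow_lt, hp).
  split.
  - apply Rmult_le_compat_r; [lra|]. apply pow_incr; lra.
  - apply Rmult_le_compat_r; [lra|].
    replace (9 * (Rabs l / 2) ^ 2) with ((3 * (Rabs l / 2)) ^ 2) by ring.
    apply pow_incr; lra.
Qed.

(** The power is replaced by a weaker exponential, which is enough against a Gaussian. *)
Lemma slow_decay_bound f alpha :
  0 < alpha -> asymp f (fun eta => Rpower eta (- alpha)) ->
  exists k M, 0 < k /\ 0 < M /\ forall t, M <= t -> k * exp (- (2 * alpha * t)) <= f t ^ 2.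
Proof.
  intros Ha H. destruct (asymp_bounds _ _ H) as [k [M [kp [Mp HM]]]].
  { intros t; apply exp_pos. }
  exists k, M. split; [exact kp|]. split; [exact Mp|]. intros t Ht.
  eapply Rle_trans; [|apply (HM t Ht)].
  apply Rmult_le_compat_l; [lra|].
  cbv beta. unfold Rpower. rewrite exp_sqr. apply exp_le.
  assert (L := ln_le_id t ltac:(lra)). nra.
Qed.

Lemma fast_decay_bound f p c :
  asymp f (fun eta => Rpower eta p * exp (- (c / 2 * eta ^ 2))) ->
  exists k q M, 0 < k /\ 0 < M /\
    forall t, M <= t -> f t ^ 2 <= k * exp (q * t - c * t ^ 2).
Proof.
  intros H. destruct (asymp_bounds _ _ H) as [k [M [kp [Mp HM]]]].
  { intros t; apply Rmult_lt_0_compat; apply exp_pos. }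
  exists (9 * k), (2 * Rabs p), (M + 1). split; [lra|]. split; [lra|]. intros t Ht.
  eapply Rle_trans; [apply (HM t); lra|].
  apply Rmult_le_compat_l; [lra|].
  cbv beta. unfold Rpower. rewrite <- exp_plus, exp_sqr. apply exp_le.
  assert (L := ln_le_id t ltac:(lra)).
  assert (L0 : 0 <= ln t) by (rewrite <- ln_1; apply ln_le; lra).
  assert (p * ln t <= Rabs p * t).
  { assert (P := Rle_abs p). assert (P0 := Rabs_pos p). nra. }
  lra.
Qed.

Section Angles.

Context (N : nat) (gamma : R).
Hypothesis N_ge1 : (1 <= N)%nat.
Hypothesis gamma_bounds : -1 < gamma < 1.

Lemma angle_right_continuous alpha f th t x :
  0 < alpha -> is_angle N gamma alpha f th -> 0 < t -> th t < x ->
  exists d, 0 < d <= 1 /\ forall beta g thb,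
    alpha < beta < alpha + d -> is_angle N gamma beta g thb -> thb t < x.
Proof.
  intros Ha Hang Ht Hx.
  destruct (angle_lipschitz_in_alpha N gamma N_ge1 gamma_bounds (alpha + 1) t)
    as [C [Cp HC]]; [lra|exact Ht|].
  set (e := (x - th t) / C).
  assert (He : 0 < e) by (apply Rdiv_lt_0_compat; lra).
  assert (EC : C * e = x - th t) by (unfold e; field; lra).
  exists (Rmin 1 e). split; [split; [apply Rmin_glb_lt; lra|apply Rmin_l]|].
  intros beta g thb Hb Hangb.
  assert (M1 := Rmin_l 1 e). assert (M2 := Rmin_r 1 e).
  specialize (HC alpha beta f g th thb ltac:(lra) ltac:(lra) Hang Hangb). nra.
Qed.

Lemma angle_left_continuous alpha f th t x :
  0 < alpha -> is_angle N gamma alpha f th -> 0 < t -> x < th t ->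
  exists d, 0 < d /\ forall beta g thb,
    0 < beta < alpha -> alpha - d < beta -> is_angle N gamma beta g thb -> x < thb t.
Proof.
  intros Ha Hang Ht Hx.
  destruct (angle_lipschitz_in_alpha N gamma N_ge1 gamma_bounds alpha t)
    as [C [Cp HC]]; [lra|exact Ht|].
  set (e := (th t - x) / C).
  assert (He : 0 < e) by (apply Rdiv_lt_0_compat; lra).
  assert (EC : C * e = th t - x) by (unfold e; field; lra).
  exists e. split; [exact He|]. intros beta g thb Hb Hbd Hangb.
  specialize (HC beta alpha g f thb th ltac:(lra) ltac:(lra) Hangb Hang). nra.
Qed.

(** The position of the angle under the barrier at one point is an open condition on
    alpha, and the barrier keeps it for ever. *)
Lemma stays_below_right_of_barrier alpha f th n t delta R0 :
  0 < alpha -> is_angle N gamma alpha f th ->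
  (forall beta u, beta <= alpha + 1 -> R0 <= u -> delta ^ 2 * u ^ 2 - INR N * delta
    + phi ((-1) ^ n * gamma) (beta - delta * u ^ 2) < 0) ->
  0 < R0 <= t -> th t < INR n * PI + atan (delta * t) ->
  exists d, 0 < d /\ forall beta g thb,
    alpha < beta < alpha + d -> is_angle N gamma beta g thb -> stays_below n thb.
Proof.
  intros Ha Hang Hbar Ht Hth.
  destruct (angle_right_continuous alpha f th t _ Ha Hang ltac:(lra) Hth)
    as [d [dp Hd]].
  exists d. split; [lra|]. intros beta g thb Hb Hangb.
  apply (stays_below_of_barrier N gamma beta g thb n delta R0 t Hangb); [|lra|].
  - intros u Hu. apply Hbar; lra.
  - apply (Hd beta g); assumption.
Qed.

(** At a large R0 the angle is below node n, hence below the barrier of index n + 1,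
    whatever the decay of f: nearby profiles can cross at most one more node. *)
Lemma stays_below_S_right alpha f th n :
  0 < alpha -> is_angle N gamma alpha f th -> stays_below n th ->
  exists d, 0 < d /\ forall beta g thb,
    alpha < beta < alpha + d -> is_angle N gamma beta g thb -> stays_below (S n) thb.
Proof.
  intros Ha Hang Hn.
  assert (G := pow_neg1_mult (S n) gamma gamma_bounds).
  set (c := (1 + (-1) ^ S n * gamma) / 2).
  assert (cp : 0 < c) by (unfold c; lra).
  destruct (barrier_at_infinity N gamma N_ge1 gamma_bounds (S n) (c / 2) (alpha + 1))
    as [R0 [Rp Hbar]]; [fold c; lra|lra|].
  apply (stays_below_right_of_barrier alpha f th (S n) R0 (c / 2) R0); auto; [lra|].
  eapply Rlt_trans; [apply Hn, Rp|apply node_lt_branch].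
Qed.

(** The energy [f^2 exp (delta u^2)] increases or decreases according to whether the
    angle is below or above the barrier [n PI + atan (delta u)], because
    [f' / f = - T]. *)
Lemma energy_derive alpha f th n delta t T :
  is_angle N gamma alpha f th -> 0 < t -> ex_derive f t ->
  th t = INR n * PI + atan T ->
  exists m, 0 < m /\
  is_derive (fun u => f u ^ 2 * exp (delta * u ^ 2)) t (m * (delta * t - T)).
Proof.
  intros (_ & Hr & _) Ht Hf ET.
  destruct (Hr t Ht) as [r [rp [E1 E2]]].
  rewrite ET, cos_add_nPI in E1. rewrite ET, sin_add_nPI, sin_atan_cos in E2.
  assert (Cp := cos_atan_pos T). set (C := cos (atan T)) in *.
  exists (2 * r ^ 2 * C ^ 2 * exp (delta * t ^ 2)).
  split.
  { repeat apply Rmult_lt_0_compat; try lra; try apply exp_pos; apply pow_lt; lra. }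
  auto_derive; [exact Hf|].
  change (Derive (fun x => f x) t) with (Derive f t).
  rewrite E1, E2.
  destruct (pow_neg1_cases n) as [->| ->]; simpl; ring.
Qed.

(** If the angle never went below the barrier, [f^2 exp (delta t^2)] would be
    nonincreasing and f would decay like a Gaussian.  Below the barrier the
    condition is open in alpha. *)
Lemma stays_below_right_of_slow alpha f th n :
  0 < alpha -> is_angle N gamma alpha f th -> (forall t, 0 < t -> ex_derive f t) ->
  asymp f (fun eta => Rpower eta (- alpha)) ->
  stays_below n th ->
  exists d, 0 < d /\ forall beta g thb,
    alpha < beta < alpha + d -> is_angle N gamma beta g thb -> stays_below n thb.
Proof.
  intros Ha Hang Hdf Hslow Hn.
  assert (G := pow_neg1_mult n gamma gamma_bounds).
  set (c := (1 + (-1) ^ n * gamma) / 2).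
  assert (cp : 0 < c) by (unfold c; lra).
  set (delta := c / 2). assert (Hdel : 0 < delta < c) by (unfold delta; lra).
  destruct (barrier_at_infinity N gamma N_ge1 gamma_bounds n delta (alpha + 1))
    as [R0 [Rp Hbar]]; [fold c; lra|lra|].
  destruct (classic (exists t, R0 <= t /\ th t < INR n * PI + atan (delta * t)))
    as [[t [Ht Hth]]|Hno].
  { apply (stays_below_right_of_barrier alpha f th n t delta R0); auto; lra. }
  exfalso.
  assert (Habove : forall t, R0 <= t -> INR n * PI + atan (delta * t) <= th t).
  { intros t Ht. apply Rnot_lt_le. intros L. apply Hno. exists t; auto. }
  assert (Hdec : forall t, R0 <= t ->
    f t ^ 2 * exp (delta * t ^ 2) <= f R0 ^ 2 * exp (delta * R0 ^ 2)).
  { intros t Ht. apply Ropp_le_cancel.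
    set (F := fun u => f u ^ 2 * exp (delta * u ^ 2)).
    change (- F R0 <= - F t).
    assert (HF : forall u, R0 <= u -> is_derive F u (Derive F u) /\ Derive F u <= 0).
    { intros u Hu. specialize (Habove u Hu).
      assert (B := Hn u ltac:(lra)). assert (A1 := atan_bound (delta * u)).
      assert (ET := branch_of_tan n (th u) ltac:(unfold node in *; lra)).
      destruct (energy_derive alpha f th n delta u _ Hang ltac:(lra) (Hdf u ltac:(lra)) ET)
        as [m [mp D]].
      rewrite (is_derive_unique F u _ D). split; [exact D|].
      rewrite ET in Habove.
      assert (Q : delta * u <= tan (th u - INR n * PI)) by (apply atan_le_reg; lra).
      nra. }
    apply (nondecreasing_of_derive (fun u => - F u) (fun u => - Derive F u)); [exact Ht| |].
    - intros u Hu. apply @is_derive_opp, HF. lra.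
    - intros u Hu. assert (H := proj2 (HF u ltac:(lra))). lra. }
  destruct (slow_decay_bound f alpha Ha Hslow) as [k [M [kp [Mp HM]]]].
  set (K := f R0 ^ 2 * exp (delta * R0 ^ 2)) in *.
  destruct (exp_quadratic_unbounded delta (2 * alpha) (K / k) (Rmax R0 M) (proj1 Hdel))
    as [t [Ht Hexp]].
  assert (M1 := Rmax_l R0 M). assert (M2 := Rmax_r R0 M).
  specialize (Hdec t ltac:(lra)). specialize (HM t ltac:(lra)).
  assert (P : k * exp (delta * t ^ 2 - 2 * alpha * t) <= K).
  { replace (delta * t ^ 2 - 2 * alpha * t)
      with (- (2 * alpha * t) + delta * t ^ 2) by ring.
    rewrite exp_plus, <- Rmult_assoc.
    eapply Rle_trans; [|exact Hdec]. apply Rmult_le_compat_r; [left; apply exp_pos|exact HM]. }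
  assert (k * (K / k) < k * exp (delta * t ^ 2 - 2 * alpha * t))
    by (apply Rmult_lt_compat_l; assumption).
  replace (k * (K / k)) with K in * by (field; lra). lra.
Qed.

(** The Riccati equation of [T = - f' / f]. *)
Lemma tangent_derive alpha f th n t :
  is_angle N gamma alpha f th -> 0 < t -> node n - PI < th t < node n ->
  let T := tan (th t - INR n * PI) in
  is_derive (fun u => tan (th u - INR n * PI)) t
    (T ^ 2 - (INR N - 1) / t * T + phi ((-1) ^ n * gamma) (alpha - t * T)).
Proof.
  intros (Hd & _) Ht Hb T.
  assert (ET := branch_of_tan n (th t) Hb). fold T in ET.
  assert (D := Hd t Ht). rewrite ET, slope_branch in D.
  assert (Cp : 0 < cos (th t - INR n * PI)) by (unfold node in Hb; apply cos_gt_0; lra).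
  assert (Q : 0 < 1 + T ^ 2) by (assert (Z := pow2_ge_0 T); lra).
  assert (Sc := sin2_cos2 (th t - INR n * PI)). unfold Rsqr in Sc.
  assert (TS : sin (th t - INR n * PI) = T * cos (th t - INR n * PI))
    by (unfold T, tan; field; lra).
  set (S := T ^ 2 - (INR N - 1) / t * T + phi ((-1) ^ n * gamma) (alpha - t * T)) in *.
  unfold tan. auto_derive.
  - repeat split; try (eexists; exact D); apply Rgt_not_eq, Cp.
  - change (Derive (fun x => th x) t) with (Derive th t).
    rewrite (is_derive_unique th t _ D).
    change (th t + - (INR n * PI)) with (th t - INR n * PI).
    rewrite TS in *. set (C := cos (th t - INR n * PI)) in *.
    field. lra.
Qed.

(** Going below the barrier once would mean staying below it, so [f^2] would be at
    least of the order of [exp (- delta t^2)] with [delta < c], against the Gaussian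
    rate c.  The value [3 / 4 * c] is one choice in [(c / 2, c)]: the lower bound
    [c / 2] is needed in [not_stays_below_of_fast]. *)
Lemma above_barrier_of_fast alpha f th n eta1 k q M :
  0 < alpha -> is_angle N gamma alpha f th -> (forall t, 0 < t -> ex_derive f t) ->
  0 < M -> 0 < k ->
  (forall t, M <= t -> f t ^ 2 <= k * exp (q * t - (1 + (-1) ^ n * gamma) / 2 * t ^ 2)) ->
  0 < eta1 -> (forall t, eta1 <= t -> node n - PI < th t) ->
  exists R1, 0 < R1 /\ forall t, R1 <= t ->
    INR n * PI + atan (3 / 4 * ((1 + (-1) ^ n * gamma) / 2) * t) <= th t.
Proof.
  intros Ha Hang Hdf Mp kp HM eta1p Hlow.
  assert (G := pow_neg1_mult n gamma gamma_bounds).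
  set (c := (1 + (-1) ^ n * gamma) / 2) in *.
  assert (cp : 0 < c) by (unfold c; lra).
  set (delta := 3 / 4 * c). assert (Hdel : 0 < delta < c) by (unfold delta; lra).
  destruct (barrier_at_infinity N gamma N_ge1 gamma_bounds n delta alpha)
    as [R0 [Rp Hbar]]; [fold c; lra|lra|].
  exists (Rmax R0 eta1). assert (M1 := Rmax_l R0 eta1). assert (M2 := Rmax_r R0 eta1).
  split; [lra|]. intros s Hs. apply Rnot_lt_le. intros Hth.
  assert (Hbelow : forall t, s <= t -> th t < INR n * PI + atan (delta * t)).
  { intros t Ht. apply (angle_below_barrier N gamma alpha f th n delta R0 s t); auto; [|lra].
    intros u Hu. apply Hbar; lra. }
  set (F := fun u => f u ^ 2 * exp (delta * u ^ 2)).
  assert (HF : forall u, s <= u -> is_derive F u (Derive F u) /\ 0 <= Derive F u).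
  { intros u Hu. specialize (Hbelow u Hu). specialize (Hlow u ltac:(lra)).
    assert (B := branch_lt_node n (delta * u)).
    assert (ET := branch_of_tan n (th u) ltac:(lra)).
    destruct (energy_derive alpha f th n delta u _ Hang ltac:(lra) (Hdf u ltac:(lra)) ET)
      as [m [mp D]].
    rewrite (is_derive_unique F u _ D). split; [exact D|].
    rewrite ET in Hbelow.
    assert (Q : tan (th u - INR n * PI) <= delta * u) by (apply atan_le_reg; lra).
    nra. }
  assert (Hinc : forall t, s <= t -> F s <= F t).
  { intros t Ht. apply (nondecreasing_of_derive F (Derive F)); [exact Ht| |];
      intros u Hu; apply HF; lra. }
  assert (Fs : 0 < F s).
  { unfold F. apply Rmult_lt_0_compat; [|apply exp_pos].
    assert (L := Hlow s ltac:(lra)). assert (B := branch_lt_node n (delta * s)).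
    assert (ET := branch_of_tan n (th s) ltac:(lra)).
    destruct Hang as (_ & Hr & _). destruct (Hr s ltac:(lra)) as [r [rp [E _]]].
    rewrite E, ET, cos_add_nPI.
    assert (Cp := cos_atan_pos (tan (th s - INR n * PI))).
    set (C := cos (atan (tan (th s - INR n * PI)))) in *.
    assert (0 < (r * C) ^ 2) by (apply pow_lt, Rmult_lt_0_compat; assumption).
    destruct (pow_neg1_cases n) as [->| ->]; nra. }
  destruct (exp_quadratic_unbounded (c - delta) q (k / F s) (Rmax s M) ltac:(lra))
    as [t [Ht Hexp]].
  assert (M3 := Rmax_l s M). assert (M4 := Rmax_r s M).
  specialize (Hinc t ltac:(lra)). specialize (HM t ltac:(lra)).
  assert (P : F s * exp ((c - delta) * t ^ 2 - q * t) <= k).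
  { set (X := (c - delta) * t ^ 2 - q * t).
    assert (F t * exp X <= k).
    { unfold F. rewrite Rmult_assoc, <- exp_plus.
      replace k with (k * exp (q * t - c * t ^ 2) * exp (delta * t ^ 2 + X)).
      - apply Rmult_le_compat_r; [left; apply exp_pos|exact HM].
      - rewrite Rmult_assoc, <- exp_plus.
        replace (q * t - c * t ^ 2 + (delta * t ^ 2 + X)) with 0 by (unfold X; ring).
        rewrite exp_0; ring. }
    eapply Rle_trans; [|exact H]. apply Rmult_le_compat_r; [left; apply exp_pos|exact Hinc]. }
  assert (F s * (k / F s) < F s * exp ((c - delta) * t ^ 2 - q * t))
    by (apply Rmult_lt_compat_l; assumption).
  replace (F s * (k / F s)) with k in * by (field; lra). lra.
Qed.

(** If both angles stayed between the same two nodes, the difference D of their tangents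
    would satisfy [D' = D^2 + D * (2 * Ta - (N - 1) / u - c * u) + c * (beta - alpha)],
    and the middle term is nonnegative for large u because [Ta >= 3 / 4 * c * u].
    This expresses that the fast decaying solution is the extremal one. *)
Lemma not_stays_below_of_fast alpha beta f g th thb n eta1 p :
  0 < alpha < beta ->
  is_angle N gamma alpha f th -> is_angle N gamma beta g thb ->
  (forall t, 0 < t -> ex_derive f t) ->
  asymp f (fun eta => Rpower eta p * exp (- ((1 + (-1) ^ n * gamma) / 4 * eta ^ 2))) ->
  0 < eta1 -> (forall t, eta1 <= t -> node n - PI < th t) ->
  ~ stays_below n thb.
Proof.
  intros Hab Hang Hangb Hdf Hfast eta1p Hlow Hn.
  assert (G := pow_neg1_mult n gamma gamma_bounds).
  destruct (fast_decay_bound f p ((1 + (-1) ^ n * gamma) / 2)) as [k [q [M [kp [Mp HM]]]]].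
  { destruct Hfast as [l [l0 Hl]]. exists l. split; [exact l0|].
    eapply is_lim_ext; [|exact Hl]. intros t. simpl.
    do 4 f_equal. field. }
  destruct (above_barrier_of_fast alpha f th n eta1 k q M) as [R1 [R1p HR1]]; auto; [lra|].
  assert (N1 := INR_ge1 N N_ge1).
  set (gn := (-1) ^ n * gamma) in *. set (c := (1 + gn) / 2) in *.
  assert (cp : 0 < c < 1) by (unfold c; lra).
  (* Beyond R2 the arguments of phi are negative for both angles, and (N - 1) / u is
     at most c * u / 2. *)
  set (R2 := R1 + eta1 + 1 + 2 * INR N / c + 2 * beta / c).
  assert (X1 : 0 < 2 * INR N / c) by (apply Rdiv_lt_0_compat; lra).
  assert (X2 : 0 < 2 * beta / c) by (apply Rdiv_lt_0_compat; lra).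
  set (Ta := fun u => tan (th u - INR n * PI)).
  set (Tb := fun u => tan (thb u - INR n * PI)).
  assert (Hlt : forall u, 0 < u -> th u < thb u)
    by (intros u Hu; apply (angle_increasing_in_alpha N gamma N_ge1 gamma_bounds alpha beta f g); auto).
  assert (Hba : forall u, R2 <= u -> node n - PI < th u < node n).
  { intros u Hu. unfold R2 in Hu. split; [apply Hlow; lra|].
    eapply Rlt_trans; [apply Hlt|apply Hn]; lra. }
  assert (Hbb : forall u, R2 <= u -> node n - PI < thb u < node n).
  { intros u Hu. unfold R2 in Hu. split; [|apply Hn; lra].
    eapply Rlt_trans; [apply Hlow|apply Hlt]; lra. }
  assert (HT : forall u, R2 <= u -> 3 / 4 * c * u <= Ta u < Tb u).
  { intros u Hu. assert (Ea := branch_of_tan n _ (Hba u Hu)).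
    assert (Eb := branch_of_tan n _ (Hbb u Hu)).
    assert (L := Hlt u ltac:(unfold R2 in Hu; lra)).
    assert (A1 := HR1 u ltac:(unfold R2 in Hu; lra)).
    change (th u = INR n * PI + atan (Ta u)) in Ea.
    change (thb u = INR n * PI + atan (Tb u)) in Eb.
    split; [apply atan_le_reg; lra|].
    apply Rnot_le_lt. intros [Q|Q]; [apply atan_increasing in Q; lra|rewrite Q in Eb; lra]. }
  set (rhs := fun a u T => T ^ 2 - (INR N - 1) / u * T + phi gn (a - u * T)).
  apply (no_global_riccati (fun u => Tb u - Ta u)
    (fun u => rhs beta u (Tb u) - rhs alpha u (Ta u)) R2).
  - intros u Hu. apply @is_derive_minus.
    + apply (tangent_derive beta g thb n u Hangb); [unfold R2 in Hu; lra|auto].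
    + apply (tangent_derive alpha f th n u Hang); [unfold R2 in Hu; lra|auto].
  - intros u Hu. specialize (HT u Hu). lra.
  - intros u Hu. specialize (HT u Hu).
    assert (U1 : 1 <= u) by (unfold R2 in Hu; lra).
    assert (U2 : 2 * INR N <= c * u).
    { replace (2 * INR N) with (c * (2 * INR N / c)) by (field; lra).
      apply Rmult_le_compat_l; unfold R2 in Hu; lra. }
    assert (U3 : 2 * beta <= c * u).
    { replace (2 * beta) with (c * (2 * beta / c)) by (field; lra).
      apply Rmult_le_compat_l; unfold R2 in Hu; lra. }
    set (x := Ta u) in *. set (D := Tb u - x).
    replace (Tb u) with (x + D) by (unfold D; ring).
    assert (Dp : 0 < D) by (unfold D; lra).
    assert (ux : beta <= u * x) by nra.
    unfold rhs. rewrite !phi_neg by nra. fold c.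
    set (kk := (INR N - 1) / u).
    assert (Hk : kk <= INR N - 1).
    { unfold kk. apply (Rmult_le_reg_r u); [lra|].
      replace ((INR N - 1) / u * u) with (INR N - 1) by (field; lra). nra. }
    assert (0 <= D * (2 * x - kk - c * u)) by (apply Rmult_le_pos; lra).
    assert (0 <= c * (beta - alpha)) by (apply Rmult_le_pos; lra).
    nra.
Qed.

(** * Counting zeros and critical exponents *)

(** Every node reached is crossed exactly once: existence by the intermediate value
    property from small angles near 0, uniqueness by [angle_upcrossing]. *)
Lemma node_crossings alpha f th n :
  0 < alpha -> is_angle N gamma alpha f th ->
  (forall j, (j < n)%nat -> exists eta, 0 < eta /\ node j <= th eta) ->
  exists l : list R, NoDup l /\ length l = n /\
    forall eta, In eta l <-> 0 < eta /\ exists j, (j < n)%nat /\ th eta = node j.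
Proof.
  intros Ha Hang. induction n as [|n IH]; intros Hreach.
  - exists nil. split; [constructor|]. split; [reflexivity|].
    intros eta. split; [intros []|intros [_ [j [Hj _]]]; lia].
  - destruct IH as [l [Hnd [Hlen Hl]]]; [intros j Hj; apply Hreach; lia|].
    destruct (Hreach n) as [b [bp Hb]]; [lia|].
    destruct (angle_small_near_zero N gamma N_ge1 gamma_bounds alpha Ha) as [e [ep He]].
    set (s := Rmin b e).
    assert (Hs : 0 < s <= b /\ s <= e)
      by (unfold s, Rmin; destruct (Rle_dec b e); lra).
    destruct (He alpha f th s ltac:(lra) Hang ltac:(lra)) as [_ Hsmall].
    assert (P := PI_RGT_0).
    assert (Hns : th s < node n).
    { assert (Q := node_mono 0 n ltac:(lia)). unfold node in Q at 1. simpl in Q. lra. }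
    destruct (first_zero (fun u => node n - th u) s b) as [z [Hz [Ez _]]]; [lra| |lra|lra|].
    { intros u Hu. apply (continuity_pt_minus (fun _ => node n) th).
      - apply derivable_continuous_pt, derivable_pt_const.
      - eapply is_derive_continuity_pt, (proj1 Hang). lra. }
    exists (z :: l). split; [|split].
    + constructor; [|exact Hnd]. intros Hin. apply Hl in Hin.
      destruct Hin as [_ [j [Hj Ej]]].
      assert (j = n) by (apply node_inj; lra). lia.
    + simpl. now rewrite Hlen.
    + intros eta. simpl. split.
      * intros [<-|Hin]; [split; [lra|exists n; split; [lia|lra]]|].
        apply Hl in Hin. destruct Hin as [p [j [Hj Ej]]].
        split; [exact p|exists j; split; [lia|exact Ej]].
      * intros [p [j [Hj Ej]]].
        destruct (Nat.eq_dec j n) as [->|ne].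
        -- left. destruct (Rtotal_order z eta) as [L|[E|L]]; [exfalso|exact E|exfalso].
           ++ assert (U := angle_upcrossing N gamma alpha f th (node n) z eta Hang
                             (cos_node n) ltac:(lra) ltac:(lra)). lra.
           ++ assert (U := angle_upcrossing N gamma alpha f th (node n) eta z Hang
                             (cos_node n) ltac:(lra) ltac:(lra)). lra.
        -- right. apply Hl. split; [exact p|exists j; split; [lia|exact Ej]].
Qed.

Lemma exactly_zeros_of_angle alpha f th n :
  0 < alpha -> f 0 = 1 -> is_angle N gamma alpha f th ->
  stays_below n th ->
  (forall j, (j < n)%nat -> exists eta, 0 < eta /\ node j <= th eta) ->
  has_exactly_zeros n f.
Proof.
  intros Ha f0 Hang Hn Hreach.
  destruct (node_crossings alpha f th n Ha Hang Hreach) as [l [Hnd [Hlen Hl]]].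
  exists l. split; [exact Hnd|split; [exact Hlen|]].
  intros eta. rewrite Hl. split.
  - intros [p [j [_ Ej]]]. split; [lra|].
    destruct (proj1 (proj2 Hang) eta p) as [r [_ [E _]]].
    rewrite E, Ej, cos_node. ring.
  - intros [[p|<-] E0]; [|lra]. split; [exact p|].
    destruct (proj1 (proj2 Hang) eta p) as [r [rp [E _]]].
    apply node_of_cos_zero.
    + split; [apply (angle_positive N gamma gamma_bounds alpha f); auto|apply Hn, p].
    + rewrite E in E0. apply Rmult_integral in E0. destruct E0; [lra|assumption].
Qed.

(** The exponents in [[lo, b]] whose angle stays below node n form an interval that is
    open on the right by hypothesis and closed by left continuity: if the angle of
    the supremum s reached node n, it would be strictly above it a little later, and
    so would the angles of the exponents slightly smaller than s. *)
Lemma stays_below_up_to (f th : R -> R -> R) n lo b :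
  (forall alpha, 0 < alpha -> is_angle N gamma alpha (f alpha) (th alpha)) ->
  0 < lo <= b -> stays_below n (th lo) ->
  (forall alpha, lo <= alpha < b -> stays_below n (th alpha) ->
     exists d, 0 < d /\ forall beta, alpha < beta < alpha + d -> stays_below n (th beta)) ->
  stays_below n (th b).
Proof.
  intros Hang Hlo Hn Hext.
  set (E := fun x => lo <= x <= b /\ stays_below n (th x)).
  destruct (completeness E) as [s [Hub Hlub]].
  { exists b. intros x [Hx _]. lra. }
  { exists lo. split; [lra|exact Hn]. }
  assert (Hls : lo <= s) by (apply Hub; split; [lra|exact Hn]).
  assert (Hsb : s <= b) by (apply Hlub; intros x [Hx _]; lra).
  assert (Hs : stays_below n (th s)).
  { intros eta Heta. apply Rnot_le_lt. intros Hge.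
    assert (U := angle_upcrossing N gamma s (f s) (th s) (node n) eta (eta + 1)
                   (Hang s ltac:(lra)) (cos_node n) ltac:(lra) Hge).
    destruct (angle_left_continuous s (f s) (th s) (eta + 1) (node n) ltac:(lra)
                (Hang s ltac:(lra)) ltac:(lra) U) as [d [dp Hd]].
    assert (s <= s - d); [|lra].
    apply Hlub. intros x [Hx Hxn]. apply Rnot_lt_le. intros Hxd.
    assert (Hxs : x <= s) by (apply Hub; split; assumption).
    specialize (Hxn (eta + 1) ltac:(lra)).
    destruct (Req_dec x s) as [->|ne]; [lra|].
    specialize (Hd x (f x) (th x) ltac:(lra) Hxd (Hang x ltac:(lra))). lra. }
  destruct (Req_dec s b) as [<-|ne]; [exact Hs|exfalso].
  destruct (Hext s ltac:(lra) Hs) as [d [dp Hd]].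
  set (x := Rmin b (s + d / 2)).
  assert (Hx : s < x <= b /\ x <= s + d / 2)
    by (unfold x, Rmin; destruct (Rle_dec b (s + d / 2)); lra).
  assert (x <= s); [|lra].
  apply Hub. split; [lra|]. apply Hd. lra.
Qed.

Lemma not_stays_below n th :
  ~ stays_below n th -> exists eta, 0 < eta /\ node n <= th eta.
Proof.
  intros H. apply NNPP. intros Hno. apply H. intros eta p.
  apply Rnot_le_lt. intros L. apply Hno. exists eta; auto.
Qed.

Lemma exponents_increasing (a : nat -> R) :
  (forall k, a k < a (S k)) -> forall i j, (i <= j)%nat -> a i <= a j.
Proof.
  intros Ha i j H. induction H as [|j _ IH]; [lra|]. specialize (Ha j). lra.
Qed.

(** So [a k] is the largest exponent with at most k zeros.  The second part for k gives the
    lower bound on the angle of [a (S k)] that fixes its branch at infinity, hence the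
    parity for which the assumed Gaussian rate is the relevant one. *)
Lemma critical_angles (f th : R -> R -> R) (a : nat -> R) :
  (forall alpha, 0 < alpha -> is_profile N gamma alpha (f alpha)) ->
  (forall alpha, 0 < alpha -> is_angle N gamma alpha (f alpha) (th alpha)) ->
  is_similarity_exponents N gamma f a ->
  forall k, stays_below k (th (a k)) /\
    forall alpha, a k < alpha -> exists eta, 0 < eta /\ node k <= th alpha eta.
Proof.
  intros Hprof Hang (apos & ainc & _ & Hfast & Hslow).
  assert (amono := exponents_increasing a ainc).
  assert (Hdf : forall alpha, 0 < alpha -> forall t, 0 < t -> ex_derive (f alpha) t).
  { intros alpha Ha t Ht. apply (Hprof alpha Ha), Ht. }
  assert (Hopen : forall n lo b, 0 < lo <= b -> stays_below n (th lo) ->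
    (forall alpha, lo <= alpha < b -> forall j, alpha <> a j) -> stays_below n (th b)).
  { intros n lo b Hlo Hn Hne. apply (stays_below_up_to f th n lo b Hang Hlo Hn).
    intros alpha Hal Hst.
    destruct (stays_below_right_of_slow alpha (f alpha) (th alpha) n) as [d [dp Hd]];
      auto; try lra; [apply Hang; lra|apply Hdf; lra|apply Hslow; [lra|auto]|].
    exists d. split; [exact dp|]. intros beta Hb. apply (Hd beta (f beta)); [lra|].
    apply Hang; lra. }
  assert (Hjump : forall k eta1, 0 < eta1 ->
    (forall t, eta1 <= t -> node k - PI < th (a k) t) ->
    forall alpha, a k < alpha -> exists eta, 0 < eta /\ node k <= th alpha eta).
  { intros k eta1 e1 Hlow alpha Hal. assert (ap := apos k).
    apply not_stays_below.
    apply (not_stays_below_of_fast (a k) alpha (f (a k)) (f alpha) (th (a k)) (th alpha)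
             k eta1 (a k - INR N)); auto; try lra; [apply Hang; lra]. }
  induction k as [|k [IHb IHj]].
  - assert (a0 := apos 0%nat). split.
    + set (m := Rmin ((1 - gamma) / 2) ((1 + gamma) / 2)).
      assert (mp : 0 < m) by (apply Rmin_glb_lt; lra).
      set (lo := Rmin (a 0%nat) (m / 2)).
      assert (Hlo : 0 < lo <= a 0%nat /\ lo <= m / 2)
        by (unfold lo, Rmin; destruct (Rle_dec (a 0%nat) (m / 2)); lra).
      apply (Hopen 0%nat lo); [lra| |].
      * apply (stays_below_small N gamma N_ge1 gamma_bounds lo (f lo)); [lra|fold m; lra|].
        apply Hang; lra.
      * intros alpha Hal j. assert (Q := amono 0%nat j ltac:(lia)). lra.
    + apply (Hjump 0%nat 1); [lra|]. intros t Ht.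
      assert (P := angle_positive N gamma gamma_bounds _ _ _ t a0 (Hang _ a0) ltac:(lra)).
      unfold node. simpl. assert (Pp := PI_RGT_0). lra.
  - assert (ak := apos k). assert (aSk := ainc k). split.
    + destruct (stays_below_S_right (a k) (f (a k)) (th (a k)) k ak (Hang _ ak) IHb)
        as [d [dp Hd]].
      set (lo := Rmin (a (S k)) (a k + d / 2)).
      assert (Hlo : a k < lo <= a (S k) /\ lo <= a k + d / 2)
        by (unfold lo, Rmin; destruct (Rle_dec (a (S k)) (a k + d / 2)); lra).
      apply (Hopen (S k) lo); [lra| |].
      * apply (Hd lo (f lo)); [lra|apply Hang; lra].
      * intros alpha Hal j. destruct (Nat.le_gt_cases j k) as [L|L].
        -- assert (Q := amono j k L). lra.
        -- assert (Q := amono (S k) j L). lra.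
    + destruct (IHj (a (S k)) aSk) as [eta [ep He]].
      apply (Hjump (S k) (eta + 1)); [lra|]. intros t Ht. rewrite node_S.
      assert (U := angle_upcrossing N gamma _ _ _ (node k) eta t (Hang (a (S k)) ltac:(lra))
                     (cos_node k) ltac:(lra) He). lra.
Qed.

End Angles.

(* The count is k + 1 on (a k, a (k + 1)], a 0 being the exponent of the
   zero-free profile: for gamma = 0 and N = 1 one has a 1 = 3 and
   f eta = (1 - eta^2 / 2) exp (- eta^2 / 4), which has one zero. *)
Theorem theorem1p2 :
  forall (N : nat) (gamma : R) (f : R -> R -> R) (a : nat -> R),
    (1 <= N)%nat ->
    -1 < gamma < 1 ->
    (forall alpha : R, 0 < alpha -> is_profile N gamma alpha (f alpha)) ->
    is_similarity_exponents N gamma f a ->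
    (forall (k : nat) (alpha : R),
       a k < alpha <= a (S k) -> has_exactly_zeros (S k) (f alpha)) /\
    (forall alpha : R, 0 < alpha <= a 0%nat ->
       forall eta : R, 0 <= eta -> 0 < f alpha eta).
Proof.
  intros N gamma f a N1 Hg Hprof Hexp.
  assert (Hch : forall alpha, exists th, 0 < alpha -> is_angle N gamma alpha (f alpha) th).
  { intros alpha. destruct (Rlt_dec 0 alpha) as [p|np].
    - destruct (angle_exists N gamma alpha (f alpha) N1 Hg p (Hprof alpha p)) as [th H].
      exists th; auto.
    - exists (fun _ => 0). intros; contradiction. }
  destruct (choice _ Hch) as [th Hang].
  assert (Hcrit := critical_angles N gamma N1 Hg f th a Hprof Hang Hexp).
  assert (Hmono : forall n alpha b, 0 < alpha <= b -> stays_below n (th b) ->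
                  stays_below n (th alpha)).
  { intros n alpha b Hab Hb eta p.
    destruct (Req_dec alpha b) as [->|ne]; [apply Hb, p|].
    eapply Rlt_trans; [|apply Hb, p].
    apply (angle_increasing_in_alpha N gamma N1 Hg alpha b (f alpha) (f b)); auto; try lra;
      apply Hang; lra. }
  assert (apos := proj1 Hexp).
  split.
  - intros k alpha Hal. assert (ak := apos k).
    apply (exactly_zeros_of_angle N gamma N1 Hg alpha (f alpha) (th alpha)).
    + lra.
    + apply (Hprof alpha). lra.
    + apply Hang. lra.
    + apply (Hmono _ _ (a (S k))); [lra|apply Hcrit].
    + intros j Hj. destruct (proj2 (Hcrit k) alpha ltac:(lra)) as [eta [p He]].
      exists eta. split; [exact p|].
      assert (Q := node_mono j k ltac:(lia)). lra.
  - intros alpha Hal eta [p|<-].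
    + assert (B := Hmono 0%nat alpha (a 0%nat) Hal (proj1 (Hcrit 0%nat)) eta p).
      assert (P := angle_positive N gamma Hg _ _ _ eta (proj1 Hal) (Hang alpha (proj1 Hal)) p).
      destruct (proj1 (proj2 (Hang alpha (proj1 Hal))) eta p) as [r [rp [E _]]].
      rewrite E. apply Rmult_lt_0_compat; [exact rp|].
      unfold node in B. simpl in B. apply cos_gt_0; lra.
    + rewrite (proj1 (Hprof alpha (proj1 Hal))). lra.
Qed.
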